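(* Let $\delta$ be a partition of an integer $r$, and let $$P(\delta;\alpha_0,\alpha_1;t_0,t_1)=\frac{\dim V_\delta}{r!}\sum_{\sigma\in\Sigma_r}\chi_\delta(\sigma)\prod_{j=1}^{q}\left(\alpha_0^{l_j}t_0+\alpha_1^{l_j}t_1\right)\in\mathbb{Q}[\alpha_0,\alpha_1,t_0,t_1],$$ where, for each $\sigma$, $l_1,\dots,l_q$ are the lengths of the cycles (including cycles of length one) in the cycle decomposition of $\sigma$. Then for every $(d_0,d_1)$ in the maximal skew hook of $\delta$ the following identity of polynomials in $\alpha_0$ and $\alpha_1$ holds: $$P(\delta;\alpha_0,\alpha_1;d_0,-d_1)=(\dim V_\delta)\,(-1)^{|\nu|}\,\frac{\dim V_\mu}{|\mu|!}\,\frac{\dim V_\nu}{|\nu|!}\,(\alpha_0-\alpha_1)^{d_0d_1}\,\alpha_0^{|\mu|}\,\alpha_1^{|\nu|}\,\mathsf{cp}_\mu(d_0)\,\mathsf{cp}_\nu(d_1),$$ where $\mu$ is the partition whose non-zero parts are the positive numbers among the $\delta_i-d_1$, and $\nu$ is the partition whose non-zero parts are the positive numbers among the $\delta'_i-d_0$.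
   Context: A partition $\delta=(\delta_1\ge\delta_2\ge\cdots>0)$ is identified with its Young diagram: $(i,j)\in\delta$ means $i,j\ge 1$ and $j\le\delta_i$. $|\delta|$ denotes the sum of its parts and $\delta'=(\delta'_1,\delta'_2,\dots)$ the transposed partition. The maximal skew hook of $\delta$ is the set $\{(i,j)\in\delta : (i+1,j+1)\notin\delta\}$. For a partition $\theta$ of $m$, $V_\theta$ is the irreducible representation of the symmetric group $\Sigma_m$ (over $\mathbb{Q}$) corresponding to $\theta$, and $\chi_\theta$ is its character; for the empty partition, $\dim V_\emptyset=1$ and $0!=1$. The content polynomial of $\theta$ is $\mathsf{cp}_\theta(t)=\prod_{(i,j)\in\theta}(t+j-i)$, which equals $1$ for $\theta=\emptyset$. *)

(* Defs.v *)
From mathcomp Require Import all_boot all_order all_algebra all_fingroup.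
From mathcomp Require Import mxrepresentation.
From mathcomp Require Export mpoly.

Set Implicit Arguments.
Unset Strict Implicit.
Unset Printing Implicit Defensive.

Import GRing.Theory.
Local Open Scope ring_scope.

(* Partitions are weakly decreasing lists of positive numbers. *)
Definition is_partition_of (m : nat) (theta : seq nat) : bool :=
  [&& sorted geq theta, 0%N \notin theta & sumn theta == m].

(* The j-th entry (from 0) counts the parts larger than j. *)
Definition conj_part (theta : seq nat) : seq nat :=
  mkseq (fun j => count (fun k => j < k)%N theta) (head 0%N theta).

(* Boxes are numbered from 1, as (row, column). *)
Definition in_diagram (theta : seq nat) (b : nat * nat) : bool :=
  [&& 1 <= b.1, 1 <= b.2 & b.2 <= nth 0 theta b.1.-1]%N.

Definition max_skew_hook (theta : seq nat) (b : nat * nat) : bool :=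
  in_diagram theta b && ~~ in_diagram theta (b.1.+1, b.2.+1).

(* The positive numbers among the theta_i - d. *)
Definition shift_part (d : nat) (theta : seq nat) : seq nat :=
  [seq (k - d)%N | k <- theta & (d < k)%N].

(* Rows and columns are numbered from 0 here; contents do not change. *)
Definition content_poly (theta : seq nat) : {poly rat} :=
  \prod_(i < size theta) \prod_(j < nth 0%N theta i)
    ('X + (j%:R - i%:R)%:P).

Section Specht.

(* V_theta, for theta a partition of m, is the right ideal c_theta Q[Sigma_m]
   generated by the Young symmetrizer
     c_theta = \sum_(p in rows) \sum_(q in columns) sgn(q) p q
   of the tableau filled row by row with 0, ..., m - 1, as a submodule of the
   (right) regular representation; reshape_index theta i and
   reshape_offset theta i are the row and the column of entry i. *)
Variables (m : nat) (theta : seq nat).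

Definition row_stab : {set 'S_m} :=
  [set s : 'S_m |
    [forall i : 'I_m, reshape_index theta (s i) == reshape_index theta i]].

Definition col_stab : {set 'S_m} :=
  [set s : 'S_m |
    [forall i : 'I_m, reshape_offset theta (s i) == reshape_offset theta i]].

Definition young_symmetrizer : 'rV[rat]_#|[set: 'S_m]| :=
  \sum_(p in row_stab) \sum_(q in col_stab)
    (-1) ^+ odd_perm q *: delta_mx 0 (gring_index [set: 'S_m]%G (p * q)%g).

Definition specht_repr :=
  submod_repr
    (cyclic_mx_module (regular_repr rat [set: 'S_m]%G) young_symmetrizer).

Definition specht_dim : nat :=
  \rank (cyclic_mx (regular_repr rat [set: 'S_m]%G) young_symmetrizer).

Definition specht_char (s : 'S_m) : rat := \tr (specht_repr s).

End Specht.

(* The variables 0, 1, 2, 3 are alpha_0, alpha_1, t_0, t_1; porbits s is the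
   set of cycles of s, including those of length one. *)
Definition P (r : nat) (delta : seq nat) : {mpoly rat[4]} :=
  ((specht_dim r delta)%:R / (r`!)%:R) *:
    \sum_(s : 'S_r) specht_char delta s *:
      \prod_(c in porbits s)
        ('X_(0 : 'I_4) ^+ #|c| * 'X_(2 : 'I_4)
         + 'X_(1 : 'I_4) ^+ #|c| * 'X_(3 : 'I_4)).

(* Main.v *)
(** The character of V_delta is the class function of the Jacobi-Trudi determinant
    det (h_(delta_i - i + j)).  Let a be the row symmetrizer, b the signed column
    antisymmetrizer and c = a b the Young symmetrizer, with c^2 = h c, and let z be
    the central element whose coefficients are the Jacobi-Trudi class function: a
    combination of the row stabilisers of all fillings.  Its coefficients count signed
    hops of fermions on a finite line; following the holes instead of the particles
    shows that z is, up to sign, also the combination of signed column stabilisers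
    given by the dual determinant.  By the uniqueness case of the
    Gale-Ryser theorem the product of the two expressions collapses to
    z^2 = \sum_g g c g^-1, while c z = c^2; since z and z (z - h) are symmetric
    matrices in the regular representation, z^2 = h z, so that
    \sum_g g c g^-1 = h z, which says that z is the character.

    By Burnside counting, (1/r!) \sum_s chi_delta(s) \prod_c p_|c| is then
    det (h_(delta_i - i + j)) for the power series H = \sum_k h_k x^k attached to the
    power sums p_l.  In the proposition
    H = (1 - alpha_1 x)^d1 / (1 - alpha_0 x)^d0.  Clearing the denominator by a
    Toeplitz matrix makes the determinant block triangular.  The lower block is the
    determinant of nu' at t = -d1.  In the upper block the entries are, up to powers
    of alpha_0, values of polynomials of degree < d0 in the index; multiplying H by
    (1 - alpha_1 x) acts on these by alpha_0 E - alpha_1, E being the unit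
    translation, which has determinant (alpha_0 - alpha_1)^d0.  The one-variable
    determinants are content polynomials by a Vandermonde evaluation. *)

Require Import Defs.
From mathcomp Require Import all_boot all_order all_algebra.
From mathcomp Require Import all_fingroup mxrepresentation fraction.
From mathcomp Require Import zify ring.
Import Order.TTheory GRing.Theory Num.Theory.
Local Open Scope ring_scope.

Set Implicit Arguments.
Unset Strict Implicit.
Unset Printing Implicit Defensive.

(** * Diagrams *)

Section Diagrams.
Local Open Scope nat_scope.

Lemma partition_sorted r lam : is_partition_of r lam -> sorted geq lam.
Proof. by case/and3P. Qed.

Lemma partition_sumn r lam : is_partition_of r lam -> sumn lam = r.
Proof. by case/and3P=> _ _ /eqP. Qed.

Lemma nth_sorted_geq lam i j :
  sorted geq lam -> i <= j -> nth 0 lam j <= nth 0 lam i.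
Proof.
move=> lam_s le_ij; case: (ltnP j (size lam)) => [lt_j|/(nth_default 0)-> //].
apply: (@sorted_leq_nth _ geq (rev_trans leq_trans) leqnn 0 lam lam_s i j) => //.
by rewrite inE (leq_ltn_trans le_ij).
Qed.

Definition conj_row lam j := count (fun k => j < k) lam.

Lemma nth_conj_part lam j : sorted geq lam -> nth 0 (conj_part lam) j = conj_row lam j.
Proof.
move=> lam_s; case: (ltnP j (head 0 lam)) => lt_j.
  by rewrite /conj_part nth_mkseq.
rewrite nth_default ?size_mkseq //; apply/esym/eqP.
rewrite -leqn0 leqNgt -has_count -all_predC; apply/(all_nthP 0) => i _ /=.
by rewrite -leqNgt (leq_trans _ lt_j) // -nth0 nth_sorted_geq.
Qed.

Lemma conj_rowP lam i j : sorted geq lam -> (i < conj_row lam j) = (j < nth 0 lam i).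
Proof.
rewrite /conj_row; elim: lam i => [|k lam IH] i /=; first by rewrite nth_nil.
move=> lam_s; have /IH{}IH := path_sorted lam_s.
have le_k m : nth 0 lam m <= k.
  by have := @nth_sorted_geq (k :: lam) 0 m.+1 lam_s; apply.
case: (ltnP j k) => lt_jk; case: i => [|i] /=.
- by rewrite lt_jk.
- by rewrite add1n ltnS IH.
- by have := le_k 0; rewrite add0n IH; lia.
by have := le_k i.+1; have := le_k i; rewrite add0n IH; lia.
Qed.

Lemma sum_nth_sumn lam n : size lam <= n -> \sum_(i < n) nth 0 lam i = sumn lam.
Proof.
elim: lam n => [|k lam IH] n /=; first by rewrite big1 // => i _; rewrite nth_nil.
by case: n => // n le_n; rewrite big_ord_recl /= IH.
Qed.

Lemma sum_conj_row lam l :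
  \sum_(j < l) conj_row lam j = \sum_(i < size lam) minn (nth 0 lam i) l.
Proof.
rewrite /conj_row; elim: lam => [|k lam IH] /=; first by rewrite big_ord0 big1.
rewrite big_split /= IH big_ord_recl /=; congr (_ + _).
elim: l {IH} => [|l IH]; first by rewrite big_ord0 minn0.
by rewrite big_ord_recr /= IH; case: ltnP; lia.
Qed.

(** With [l = nth 0 lam k], rows before [k] have length at least [l] and the others at most [l]. So
    the first [k] rows and the first [l] columns cover the diagram and meet in a full rectangle. *)
Lemma sum_conj_row_corner lam k : sorted geq lam ->
  \sum_(j < nth 0 lam k) conj_row lam j + \sum_(i < k) nth 0 lam i
  = k * nth 0 lam k + sumn lam.
Proof.
move=> lam_s; rewrite sum_conj_row.
set n := maxn (size lam) k; set l := nth 0 lam k.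
have -> : \sum_(i < size lam) minn (nth 0 lam i) l = \sum_(i < n) minn (nth 0 lam i) l.
  rewrite -!(big_mkord xpredT (fun i => minn (nth 0 lam i) l)).
  rewrite [RHS](big_cat_nat (n := size lam)) ?leq_maxl //= [X in _ + X]big_nat.
  by rewrite [X in _ + X]big1 ?addn0 // => i /andP[? _]; rewrite nth_default ?min0n.
rewrite -(@sum_nth_sumn lam n) ?leq_maxl //.
rewrite -!(big_mkord xpredT (fun i => minn (nth 0 lam i) l)).
rewrite (big_cat_nat (n := k) (p := n)) ?leq_maxr //=.
have toN m : \sum_(i < m) nth 0 lam i = \sum_(0 <= i < m) nth 0 lam i by rewrite big_mkord.
rewrite !toN [\sum_(0 <= i < n) nth 0 lam i](big_cat_nat (n := k)) ?leq_maxr //=.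
have -> : \sum_(0 <= i < k) minn (nth 0 lam i) l = k * l.
  rewrite -{2}(subn0 k) -sum_nat_const_nat; apply: eq_big_nat => i /andP[_ lt_ik].
  by apply/minn_idPr/nth_sorted_geq => //; apply: ltnW.
have -> : \sum_(k <= i < n) minn (nth 0 lam i) l = \sum_(k <= i < n) nth 0 lam i.
  apply: eq_big_nat => i /andP[le_ki _].
  by apply/minn_idPl/nth_sorted_geq.
by lia.
Qed.

(* The uniqueness case of the Gale-Ryser theorem, for dominated margins: the
   inclusion-exclusion count of the cells in the first [k] rows or the first
   [nth 0 lam k] columns leaves no room for cells outside the diagram. *)
Lemma injective_in_diagram (T : finType) lam (a b : T -> nat) :
    sorted geq lam -> #|T| = sumn lam ->
    (forall x y, a x = a y -> b x = b y -> x = y) ->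
    (forall k, \sum_(i < k) nth 0 lam i <= #|[set x | a x < k]|) ->
    (forall l, \sum_(j < l) conj_row lam j <= #|[set x | b x < l]|) ->
  forall x, b x < nth 0 lam (a x).
Proof.
move=> lam_s cardT ab_inj Ha Hb x0.
(* This [k] keeps [x0] out of [A]; once [A] and [B] cover [T], [x0] lies in [B], which is the
   claim. *)
set k := a x0; set l := nth 0 lam k.
pose A := [set x | a x < k]; pose B := [set x | b x < l].
have le_kl : #|A :&: B| <= k * l.
  pose f x : option ('I_k * 'I_l) :=
    if insub (a x) is Some i then if insub (b x) is Some j then Some (i, j) else None
    else None.
  have f_inj : {in A :&: B &, injective f}.
    move=> x y; rewrite !inE /f => /andP[ax bx] /andP[ay bY].
    by rewrite !insubT /= => -[]; apply: ab_inj.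
  have fE : f @: (A :&: B) \subset [set~ None].
    apply/subsetP => y /imsetP[x xAB ->{y}]; move: xAB; rewrite !inE => /andP[ax bx].
    by rewrite /f !insubT.
  rewrite -(card_in_imset f_inj) (leq_trans (subset_leq_card fE)) //.
  by rewrite cardsC1 card_option card_prod !card_ord.
have := sum_conj_row_corner k lam_s; rewrite -cardT -/l.
have := cardsUI A B; have := Ha k; have := Hb l; rewrite -/A -/B => H1 H2 H3 H4.
have : A :|: B == setT by rewrite eqEcard subsetT cardsT; lia.
by move/eqP/setP/(_ x0); rewrite !inE ltnn.
Qed.

End Diagrams.

Section TableauCount.
Local Open Scope nat_scope.
Variables (r : nat) (lam : seq nat).
Hypothesis lamP : is_partition_of r lam.

Let lam_s := partition_sorted lamP.
Let lam_sum := partition_sumn lamP.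

Lemma flatten_index_lt i j : j < nth 0 lam i -> flatten_index lam i j < r.
Proof. by move/flatten_indexP; rewrite lam_sum. Qed.

Lemma reshape_offset_lt (x : 'I_r) :
  reshape_offset lam x < nth 0 lam (reshape_index lam x).
Proof. by rewrite reshape_offsetP ?lam_sum. Qed.

Lemma reshape_index_lt (x : 'I_r) : reshape_index lam x < size lam.
Proof. by rewrite reshape_indexP ?lam_sum. Qed.

Lemma card_reshape_index i :
  #|[set x : 'I_r | reshape_index lam x == i]| = nth 0 lam i.
Proof.
pose f (j : 'I_(nth 0 lam i)) := Ordinal (flatten_index_lt (ltn_ord j)).
have f_inj : injective f.
  move=> j k /(congr1 val) /= /(congr1 (reshape_offset lam)).
  by rewrite !flatten_indexKr // => /val_inj.
rewrite -[RHS]card_ord -(card_imset _ f_inj); apply: eq_card => x; rewrite inE.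
apply/eqP/imsetP => [eq_i|[j _ ->]]; last by rewrite /= flatten_indexKl.
have lt_j : reshape_offset lam x < nth 0 lam i by rewrite -eq_i reshape_offset_lt.
by exists (Ordinal lt_j) => //; apply: val_inj; rewrite /= -eq_i reshape_indexK.
Qed.

Lemma card_reshape_offset j :
  #|[set x : 'I_r | reshape_offset lam x == j]| = conj_row lam j.
Proof.
have lt_row (i : 'I_(conj_row lam j)) : j < nth 0 lam i by rewrite -conj_rowP.
pose f i := Ordinal (flatten_index_lt (lt_row i)).
have f_inj : injective f.
  move=> i k /(congr1 val) /= /(congr1 (reshape_index lam)).
  by rewrite !flatten_indexKl // => /val_inj.
rewrite -[RHS]card_ord -(card_imset _ f_inj); apply: eq_card => x; rewrite inE.
apply/eqP/imsetP => [eq_j|[i _ ->]]; last by rewrite /= flatten_indexKr.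
have lt_i : reshape_index lam x < conj_row lam j.
  by rewrite conj_rowP // -eq_j reshape_offset_lt.
by exists (Ordinal lt_i) => //; apply: val_inj; rewrite /= -eq_j reshape_indexK.
Qed.

Lemma reshape_pair_inj (x y : 'I_r) :
  reshape_index lam x = reshape_index lam y ->
  reshape_offset lam x = reshape_offset lam y -> x = y.
Proof.
move=> eq_i eq_o; apply: val_inj.
by rewrite -[val x](reshape_indexK lam) -[val y](reshape_indexK lam) eq_i eq_o.
Qed.

Lemma tableau_perm (a b : 'I_r -> nat) :
    (forall x y, a x = a y -> b x = b y -> x = y) ->
    (forall x, b x < nth 0 lam (a x)) ->
  exists g : 'S_r, forall x,
    a x = reshape_index lam (g x) /\ b x = reshape_offset lam (g x).
Proof.
move=> ab_inj ab_lt; pose f x := Ordinal (flatten_index_lt (ab_lt x)).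
have fP x : reshape_index lam (f x) = a x /\ reshape_offset lam (f x) = b x.
  by rewrite /= flatten_indexKl // flatten_indexKr.
have f_inj : injective f.
  move=> x y eq_f; apply: ab_inj.
    by rewrite -(fP x).1 -(fP y).1 eq_f.
  by rewrite -(fP x).2 -(fP y).2 eq_f.
exists (perm f_inj) => x; rewrite permE.
by have [-> ->] := fP x.
Qed.

End TableauCount.

(** * Jacobi-Trudi coefficients and dominance *)

Section JTCoefficients.

Definition fiber_card (T : finType) n (a : T -> 'I_n) (i : 'I_n) : nat :=
  #|[set x | a x == i]|.

(* The coefficient of the colourings of content [c] in the expansion of the
   Jacobi-Trudi determinant [det (h_(lam_i + j - i))] *)
Definition jt_coef n (lam : nat -> nat) (c : 'I_n -> nat) : rat :=
  \det (\matrix_(i < n, j < n) (lam i + j == c i + i)%N%:R).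

Lemma eq_jt_coef n (lam lam' : nat -> nat) (c c' : 'I_n -> nat) :
  lam =1 lam' -> c =1 c' -> jt_coef lam c = jt_coef lam' c'.
Proof.
move=> eq_lam eq_c; congr (\det _); apply/matrixP => i j.
by rewrite !mxE eq_lam eq_c.
Qed.

Lemma jt_coef_id n (lam : nat -> nat) (c : 'I_n -> nat) :
  (forall i : 'I_n, c i = lam i) -> jt_coef lam c = 1.
Proof.
move=> eq_c; rewrite -(det1 rat n); congr (\det _); apply/matrixP => i j.
by rewrite !mxE eq_c eqn_add2l eq_sym.
Qed.

Lemma jt_coef_neq0 n (lam : nat -> nat) (c : 'I_n -> nat) :
  jt_coef lam c != 0 -> exists w : 'S_n, forall i : 'I_n, (lam i + w i = c i + i)%N.
Proof.
move=> nz; suff /existsP[w /forallP wE] : [exists w : 'S_n, [forall i : 'I_n, (lam i + w i == c i + i)%N]].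
  by exists w => i; apply/eqP.
apply: contraNT nz => /existsPn no_w; apply/eqP.
rewrite /jt_coef /determinant big1 // => w _.
have /forallPn[i ne_i] := no_w w.
by rewrite (bigD1 i) //= mxE (negbTE ne_i) mul0r mulr0.
Qed.

(** Exchange argument: the initial segment [A] and its image [B] have equal size; outside their
    intersection the elements of [A] are below [k], those of [B] are not. *)
Lemma sum_perm_prefix n (w : 'S_n) k :
  (\sum_(i < n | i < k) i <= \sum_(i < n | i < k) w i)%N.
Proof.
set A := [set i : 'I_n | (i < k)%N]; set B := w @: A.
have cardB : #|B| = #|A| by rewrite card_imset //; apply: perm_inj.
have eqA : (\sum_(i < n | i < k) i = \sum_(i in A) i)%N by apply: eq_bigl => i; rewrite inE.
have eqB : (\sum_(i < n | i < k) w i = \sum_(i in B) i)%N.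
  rewrite big_imset /=; last by move=> i j _ _; apply: perm_inj.
  by apply: eq_bigl => i; rewrite inE.
rewrite eqA eqB (big_setID B) [X in (_ <= X)%N](big_setID A) /= setIC leq_add2l.
have cardD : #|A :\: B| = #|B :\: A|.
  apply/eqP; rewrite -(eqn_add2l #|A :&: B|) cardsID [A :&: B]setIC cardsID.
  exact/eqP/esym.
apply: (@leq_trans (#|A :\: B| * k)); last rewrite cardD.
  by rewrite -sum_nat_const leq_sum // => i; rewrite !inE => /andP[_ /ltnW].
by rewrite -sum_nat_const leq_sum // => i; rewrite !inE -leqNgt => /andP[].
Qed.

Lemma card_prefix_fiber (T : finType) n (a : T -> 'I_n) k :
  #|[set x | (a x < k)%N]| = (\sum_(i < n | (i < k)%N) fiber_card a i)%N.
Proof.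
rewrite -sum1_card (partition_big a (fun i : 'I_n => (i < k)%N)) => [|x]; last by rewrite inE.
apply: eq_bigr => i lt_ik; rewrite /fiber_card -sum1_card; apply: eq_bigl => x; rewrite !inE.
by case: eqP => [->|]; rewrite ?lt_ik ?andbF.
Qed.

(** A non-zero term of the determinant gives [w] with content [lam i + w i - i], and the corrections
    [w i - i] have non-negative partial sums. This supplies the margins for
    [injective_in_diagram]. *)
Lemma jt_coef_dominates (T : finType) n (lam : nat -> nat) (a : T -> 'I_n) k :
    (forall i, n <= i -> lam i = 0)%N ->
    jt_coef lam (fiber_card a) != 0 ->
  (\sum_(i < k) lam i <= #|[set x | (a x < k)%N]|)%N.
Proof.
move=> lam0 /jt_coef_neq0[w wE].
have eq_sum : (\sum_(i < k) lam i = \sum_(i < n | (i < k)%N) lam i)%N.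
  rewrite (big_ord_widen (maxn n k) lam) ?leq_maxr //.
  rewrite (@big_ord_widen_cond _ _ _ n (maxn n k) (fun i => (i < k)%N) lam) ?leq_maxl //.
  rewrite [RHS]big_mkcondr; apply: eq_bigr => i _.
  by case: ltnP => // /lam0 ->.
rewrite card_prefix_fiber eq_sum -(leq_add2r (\sum_(i < n | (i < k)%N) i)) -[leqRHS]big_split /=.
rewrite (leq_trans (leq_add (leqnn _) (sum_perm_prefix w k))) // -big_split /=.
by apply: leq_sum => i _; rewrite wE.
Qed.

End JTCoefficients.

(** * Stabilisers of colourings and the Young symmetrizer *)

Section Colorings.
Variables (r : nat) (X : eqType).
Implicit Types (f : 'I_r -> X) (s t g : 'S_r).

Definition stab f : {set 'S_r} := [set s : 'S_r | [forall x, f (s x) == f x]].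

Lemma stabP f s : reflect (forall x, f (s x) = f x) (s \in stab f).
Proof. by rewrite inE; apply: (iffP forallP) => H x; apply/eqP. Qed.

Lemma eq_stab f f' : f =1 f' -> stab f = stab f'.
Proof. by move=> eq_f; apply/setP => s; rewrite !inE; apply: eq_forallb => x; rewrite !eq_f. Qed.

Lemma stab1 f : 1%g \in stab f.
Proof. by apply/stabP => x; rewrite perm1. Qed.

Lemma stabV f s : (s^-1%g \in stab f) = (s \in stab f).
Proof.
suff W t : t \in stab f -> t^-1%g \in stab f.
  by apply/idP/idP => /W; rewrite ?invgK.
by move/stabP => tf; apply/stabP => x; rewrite -{2}[x](permKV t) tf.
Qed.

Lemma stabMl f t s : t \in stab f -> (t * s \in stab f)%g = (s \in stab f).
Proof.
have W u v : u \in stab f -> v \in stab f -> (u * v)%g \in stab f.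
  by move=> /stabP uf /stabP vf; apply/stabP => x; rewrite permM vf uf.
move=> tf; apply/idP/idP; last exact: W.
by rewrite -{2}[s](mulKg t); apply: W; rewrite stabV.
Qed.

Lemma stabMr f t s : t \in stab f -> (s * t \in stab f)%g = (s \in stab f).
Proof. by move=> tf; rewrite -[LHS]stabV invgM stabMl stabV. Qed.

Lemma stab_comp f g s : (s \in stab (f \o g)) = (g^-1 * s * g \in stab f)%g.
Proof.
apply/stabP/stabP => H x; first by have := H (g^-1%g x); rewrite !permM /= permKV.
by have := H (g x); rewrite !permM permK.
Qed.

Lemma tperm_stab f x y : f x = f y -> tperm x y \in stab f.
Proof. by move=> eq_f; apply/stabP => z; case: tpermP => // ->. Qed.

End Colorings.

Section StabilizerSums.
Variable r : nat.
Local Notation G := [set: 'S_r]%G.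
Local Notation rG := (regular_repr rat G).
Implicit Types (s t g : 'S_r) (e : bool).

Let rGM s t : rG (s * t)%g = rG s *m rG t.
Proof. by rewrite repr_mxM ?inE. Qed.

Let sgnM e s t : (-1) ^+ (e && odd_perm (s * t)%g)
  = (-1) ^+ (e && odd_perm s) * (-1) ^+ (e && odd_perm t) :> rat.
Proof. by case: e => /=; rewrite ?mulr1 // odd_permM signr_addb. Qed.

Let sgnV e s : (-1) ^+ (e && odd_perm s^-1%g) = (-1) ^+ (e && odd_perm s) :> rat.
Proof. by rewrite odd_permV. Qed.

Let sgn2 e s : (-1) ^+ (e && odd_perm s) * (-1) ^+ (e && odd_perm s) = 1 :> rat.
Proof. by rewrite -signr_addb addbb. Qed.

Lemma regular_repr_tr s : (rG s)^T = rG s^-1%g.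
Proof.
apply/matrixP => i j; rewrite !mxE !eqxx /=; congr (_%:R); congr nat_of_bool.
rewrite -(inj_eq (can_inj (@gring_valK _ G)) i) -(inj_eq (can_inj (@gring_valK _ G)) j).
rewrite !gring_indexK ?inE //; apply/eqP/eqP => ->; first by rewrite mulgK.
by rewrite mulgKV.
Qed.

(** Positivity over the rationals: the diagonal entries of [M *m M^T] are sums of squares. In
    particular a symmetric matrix with zero square is zero. *)
Lemma mulmx_trmx_eq0 m n (M : 'M[rat]_(m, n)) : M *m M^T = 0 -> M = 0.
Proof.
move=> M0; apply/matrixP => i j; rewrite mxE; apply/eqP.
have /matrixP/(_ i i) := M0; rewrite !mxE => /eqP.
rewrite psumr_eq0; last by move=> k _; rewrite mxE -expr2 sqr_ge0.
by move/allP/(_ j); rewrite mem_index_enum mxE -expr2 sqrf_eq0 => /(_ isT).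
Qed.

(** The flag [e] switches the signs on, so that row symmetrizers and column antisymmetrizers share
    their lemmas. *)
Definition stabsum (X : eqType) e (f : 'I_r -> X) : 'M[rat]_(gcard G) :=
  \sum_(s in stab f) (-1) ^+ (e && odd_perm s) *: rG s.

Lemma eq_stabsum (X : eqType) e (f f' : 'I_r -> X) :
  f =1 f' -> stabsum e f = stabsum e f'.
Proof. by move=> /eq_stab eq_f; rewrite /stabsum eq_f. Qed.

Section Coloring.
Variable X : eqType.
Implicit Types f : 'I_r -> X.

Lemma stabsum_mulr e f t : t \in stab f ->
  stabsum e f *m rG t = (-1) ^+ (e && odd_perm t) *: stabsum e f.
Proof.
move=> tf; rewrite /stabsum mulmx_suml scaler_sumr.
rewrite [RHS](reindex_inj (mulIg t)) /=.
apply: eq_big => [s|s _]; first by rewrite stabMr.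
by rewrite -scalemxAl -rGM scalerA sgnM mulrCA sgn2 mulr1.
Qed.

Lemma stabsum_mull e f t : t \in stab f ->
  rG t *m stabsum e f = (-1) ^+ (e && odd_perm t) *: stabsum e f.
Proof.
move=> tf; rewrite /stabsum mulmx_sumr scaler_sumr.
rewrite [RHS](reindex_inj (mulgI t)) /=.
apply: eq_big => [s|s _]; first by rewrite stabMl.
by rewrite -scalemxAr -rGM scalerA sgnM mulrA sgn2 mul1r.
Qed.

Lemma stabsum_tr e f : (stabsum e f)^T = stabsum e f.
Proof.
rewrite /stabsum raddf_sum [RHS](reindex_inj invg_inj) /=.
apply: eq_big => [s|s _]; first by rewrite stabV.
by rewrite linearZ /= regular_repr_tr sgnV.
Qed.

Lemma stabsum_comp e f g :
  stabsum e (f \o g) = rG g *m stabsum e f *m rG g^-1%g.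
Proof.
rewrite /stabsum mulmx_sumr mulmx_suml (reindex_inj (conjg_inj g^-1%g)) /=.
apply: eq_big => [s|s _]; first by rewrite stab_comp conjgE invgK !mulgA mulVg mul1g mulgKV.
rewrite -scalemxAr -scalemxAl -!rGM conjgE invgK !sgnM sgnV.
by rewrite mulrCA sgn2 mulr1 mulgA.
Qed.

End Coloring.

(** The transposition of [x] and [y] lies in both stabilisers: inserted between the factors, it is
    absorbed on the left without sign and on the right with sign -1. *)
Lemma stabsum_mul0 (X Y : eqType) (f : 'I_r -> X) (f' : 'I_r -> Y) x y :
  x != y -> f x = f y -> f' x = f' y -> stabsum false f *m stabsum true f' = 0.
Proof.
move=> ne_xy /tperm_stab tf /tperm_stab tf'.
have := stabsum_mull true tf'; rewrite odd_tperm ne_xy /= expr1 scaleN1r => E.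
have := congr1 (fun M => M *m stabsum true f') (stabsum_mulr false tf) => /=.
rewrite scale1r -mulmxA E mulmxN => /eqP; rewrite eq_sym -addr_eq0 -mulr2n.
by rewrite -scaler_nat scaler_eq0 pnatr_eq0 => /eqP.
Qed.

End StabilizerSums.

Lemma regular_reprE r (s x y : 'S_r) :
  regular_repr rat [set: 'S_r]%G s (gring_index [set: 'S_r]%G x) (gring_index [set: 'S_r]%G y)
  = (x * s == y)%g%:R.
Proof.
rewrite !mxE eqxx /= -(inj_eq (can_inj (@gring_valK _ [set: 'S_r]%G))).
by rewrite !gring_indexK ?inE // eq_sym.
Qed.

Lemma stabsum_sqr r (X : eqType) e (f : 'I_r -> X) :
  stabsum e f *m stabsum e f = #|stab f|%:R *: stabsum e f.
Proof.
rewrite {1}/stabsum mulmx_suml -sum1_card natr_sum scaler_suml.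
apply: eq_bigr => s sf; rewrite -scalemxAl stabsum_mull // scalerA.
by rewrite -signr_addb addbb.
Qed.

Lemma sandwich_sum (I J : finType) (P : pred I) (Q : pred J) k
    (M N : 'M[rat]_k) (F : I -> J -> 'M_k) :
  M *m (\sum_(i | P i) \sum_(j | Q j) F i j) *m N
  = \sum_(i | P i) \sum_(j | Q j) M *m F i j *m N.
Proof.
rewrite mulmx_sumr mulmx_suml; apply: eq_bigr => i _.
by rewrite mulmx_sumr mulmx_suml.
Qed.

Section YoungSymmetrizer.
Variables (r : nat) (lam : seq nat) (n m : nat).
Hypotheses (lamP : is_partition_of r lam) (le_n : (size lam <= n)%N).
Hypothesis (le_m : forall i, (nth 0 lam i <= m)%N).
Local Notation G := [set: 'S_r]%G.
Local Notation rG := (regular_repr rat G).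
Local Notation rowlen := (nth 0%N lam).
Local Notation collen := (conj_row lam).

Let lam_s := partition_sorted lamP.

Let rGM (s t : 'S_r) : rG (s * t)%g = rG s *m rG t.
Proof. by rewrite repr_mxM ?inE. Qed.

Let rGKV k (M : 'M_(k, _)) g : M *m rG g^-1%g *m rG g = M.
Proof. by rewrite -mulmxA -rGM mulVg repr_mx1 mulmx1. Qed.

Definition tab_row (x : 'I_r) : 'I_n :=
  Ordinal (leq_trans (reshape_index_lt lamP x) le_n).

Definition tab_col (x : 'I_r) : 'I_m :=
  Ordinal (leq_trans (reshape_offset_lt lamP x) (le_m _)).

Local Notation A := (stabsum false tab_row).
Local Notation B := (stabsum true tab_col).
Local Notation c := (A *m B).

Definition row_coef (a : 'I_r -> 'I_n) : rat := jt_coef rowlen (fiber_card a).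
Definition col_coef (b : 'I_r -> 'I_m) : rat := jt_coef collen (fiber_card b).

Lemma fiber_card_comp k (a : 'I_r -> 'I_k) (g : 'S_r) i :
  fiber_card (a \o g) i = fiber_card a i.
Proof.
rewrite /fiber_card -[RHS](card_imset _ (@perm_inj _ g^-1%g)).
apply: eq_card => x; rewrite inE /=; apply/idP/imsetP => [gx|[y]].
  by exists (g x); rewrite ?permK // inE.
by rewrite inE => ay ->; rewrite permKV.
Qed.

Lemma row_coef_comp a (g : 'S_r) : row_coef (a \o g) = row_coef a.
Proof. by apply: eq_jt_coef => // i; rewrite fiber_card_comp. Qed.

Lemma col_coef_comp b (g : 'S_r) : col_coef (b \o g) = col_coef b.
Proof. by apply: eq_jt_coef => // i; rewrite fiber_card_comp. Qed.

Lemma row_coef_tab : row_coef tab_row = 1.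
Proof. by apply: jt_coef_id => i; rewrite -(card_reshape_index lamP i). Qed.

Lemma col_coef_tab : col_coef tab_col = 1.
Proof. by apply: jt_coef_id => j; rewrite -(card_reshape_offset lamP j). Qed.

(** A non-zero product makes [(a, b)] injective by [stabsum_mul0]; non-zero coefficients make both
    contents dominate the margins of the diagram. By Gale-Ryser uniqueness [(a, b)] fills the
    diagram, so it is a relabelled tableau. *)
Lemma stabsum_mul_neq0 (a : 'I_r -> 'I_n) (b : 'I_r -> 'I_m) :
    row_coef a != 0 -> col_coef b != 0 ->
    stabsum false a *m stabsum true b != 0 ->
  exists g : 'S_r, a =1 tab_row \o g /\ b =1 tab_col \o g.
Proof.
move=> /jt_coef_dominates Ha /jt_coef_dominates Hb nz.
have ab_inj x y : val (a x) = val (a y) -> val (b x) = val (b y) -> x = y.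
  move=> /val_inj eq_a /val_inj eq_b; apply/eqP; apply: contraNT nz => ne_xy.
  by rewrite (stabsum_mul0 ne_xy).
have ab_lt x : (val (b x) < rowlen (val (a x)))%N.
  apply: (@injective_in_diagram _ lam (val \o a) (val \o b)) => // [|k|l].
  - by rewrite card_ord (partition_sumn lamP).
  - by apply: Ha => i le_ni; rewrite nth_default // (leq_trans le_n).
  apply: Hb => i le_mi; apply/eqP; rewrite -leqn0 leqNgt conj_rowP //.
  by rewrite -leqNgt (leq_trans (le_m 0)).
have [g gP] := tableau_perm lamP ab_inj ab_lt.
by exists g; split=> x; apply: val_inj => /=; have [] := gP x.
Qed.

Lemma tab_inj x y : tab_row x = tab_row y -> tab_col x = tab_col y -> x = y.
Proof.
move=> /(congr1 val) eq_r /(congr1 val) eq_c.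
exact: (@reshape_pair_inj r lam).
Qed.

Lemma youngE : c = \sum_(p in stab tab_row) \sum_(q in stab tab_col)
  (-1) ^+ odd_perm q *: rG (p * q)%g.
Proof.
rewrite /stabsum mulmx_suml; apply: eq_bigr => p _.
rewrite /= scale1r mulmx_sumr; apply: eq_bigr => q _.
by rewrite -scalemxAr -rGM.
Qed.

(** The coefficient of the identity is 1: a permutation preserving rows and columns is trivial, so
    [p * q = 1] only for [p = q = 1]. *)
Lemma young_neq0 : c != 0.
Proof.
apply/eqP => c0; have /eqP[] := oner_neq0 rat.
have /matrixP/(_ (gring_index G 1%g) (gring_index G 1%g)) := c0.
rewrite youngE summxE (bigD1 1%g) ?stab1 //= summxE (bigD1 1%g) ?stab1 //=.
rewrite [X in _ + X]big1 => [|p /andP[pA ne_p1]]; last first.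
  rewrite summxE big1 // => q qB; rewrite mxE regular_reprE mul1g.
  case: eqP => [eq_pq|_]; last by rewrite mulr0.
  case/eqP: ne_p1; apply/permP => x; rewrite perm1; apply: tab_inj.
    exact: (stabP _ _ pA).
  have pB : p \in stab tab_col.
    by rewrite -[p]mulg1 -(mulgV q) mulgA eq_pq mul1g stabV.
  exact: (stabP _ _ pB).
rewrite addr0 [X in _ + X]big1 => [|q /andP[_ ne_q1]]; last first.
  by rewrite mxE regular_reprE !mul1g (negbTE ne_q1) mulr0.
by rewrite mxE regular_reprE mulg1 mulg1 eqxx odd_perm1 addr0 mulr1 mxE.
Qed.

(** Moving [g] past [B] turns its colouring into [tab_col \o g]. If the product survives,
    [stabsum_mul_neq0] writes [g] as a row permutation [h] times a column permutation, and [A] and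
    [B] absorb the two factors. *)
Lemma sandwich (g : 'S_r) : exists k : rat, A *m rG g *m B = k *: c.
Proof.
have [->|nz] := eqVneq (A *m rG g *m B) 0; first by exists 0; rewrite scale0r.
have eqB : rG g *m B = stabsum true (tab_col \o g) *m rG g.
  by rewrite stabsum_comp rGKV.
have [|||h [h_row h_col]] := @stabsum_mul_neq0 tab_row (tab_col \o g).
- by rewrite row_coef_tab oner_eq0.
- by rewrite col_coef_comp col_coef_tab oner_eq0.
- by apply: contraNneq nz => E; rewrite -mulmxA eqB mulmxA E mul0mx.
have hA : h \in stab tab_row by apply/stabP => x; rewrite [RHS]h_row.
have hB : (h^-1 * g)%g \in stab tab_col.
  by apply/stabP => x; have /= := h_col (h^-1%g x); rewrite permM permKV.
exists ((-1) ^+ odd_perm (h^-1 * g)%g).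
rewrite -{1}[g](mulKVg h) rGM mulmxA (stabsum_mulr _ hA) scale1r -mulmxA.
by rewrite (stabsum_mull _ hB) /= scalemxAr.
Qed.

Lemma young_sqr : exists2 h : rat, h != 0 & c *m c = h *: c.
Proof.
have [k kP] := fin_all_exists sandwich.
have [h hP] : exists h : rat, c *m c = h *: c.
  exists (\sum_(q in stab tab_col) \sum_(p in stab tab_row) (-1) ^+ odd_perm q * k (q * p)%g).
  have -> : c *m c = A *m (B *m A) *m B by rewrite !mulmxA.
  have -> : B *m A = \sum_(q in stab tab_col) \sum_(p in stab tab_row)
      (-1) ^+ odd_perm q *: rG (q * p)%g.
    rewrite [B]/stabsum mulmx_suml; apply: eq_bigr => q _.
    rewrite mulmx_sumr; apply: eq_bigr => p _.
    by rewrite /= scale1r -scalemxAl -rGM.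
  rewrite sandwich_sum scaler_suml; apply: eq_bigr => q _.
  rewrite scaler_suml; apply: eq_bigr => p _.
  by rewrite -scalemxAr -scalemxAl kP scalerA.
exists h => //; apply: contraNneq young_neq0 => h0.
move: hP; rewrite h0 scale0r => c2.
(* Positivity is applied twice: [A B A] times its transpose is a multiple of [c c A], so
   [A B A = 0]; then [A B] times its transpose is a multiple of [A B A], so [c = 0]. *)
have A2 := stabsum_sqr false tab_row; have B2 := stabsum_sqr true tab_col.
have ABA : A *m B *m A = 0.
  apply: mulmx_trmx_eq0; rewrite !trmx_mul !stabsum_tr.
  have -> : A *m B *m A *m (A *m (B *m A)) = A *m B *m (A *m A) *m B *m A.
    by rewrite !mulmxA.
  rewrite A2 -scalemxAr -!scalemxAl.
  have -> : A *m B *m A *m B *m A = A *m B *m (A *m B) *m A by rewrite !mulmxA.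
  by rewrite c2 mul0mx scaler0.
apply/eqP/mulmx_trmx_eq0; rewrite trmx_mul !stabsum_tr.
have -> : A *m B *m (B *m A) = A *m (B *m B) *m A by rewrite !mulmxA.
by rewrite B2 -scalemxAr -scalemxAl ABA scaler0.
Qed.

(** [row_elt] is the central element [z] and [col_elt] its dual expression; the coefficients of
    [conj_sum] are, up to a scalar, the Specht character. *)
Definition row_elt := \sum_(a : {ffun 'I_r -> 'I_n}) row_coef a *: stabsum false a.
Definition col_elt := \sum_(b : {ffun 'I_r -> 'I_m}) col_coef b *: stabsum true b.
Definition conj_sum := \sum_(g : 'S_r) rG g *m c *m rG g^-1%g.

Lemma row_elt_tr : row_elt^T = row_elt.
Proof. by rewrite raddf_sum /=; apply: eq_bigr => a _; rewrite linearZ /= stabsum_tr. Qed.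

Lemma row_elt_comm g : rG g *m row_elt = row_elt *m rG g.
Proof.
rewrite /row_elt mulmx_sumr mulmx_suml.
pose h (g : 'S_r) (a : {ffun 'I_r -> 'I_n}) : {ffun 'I_r -> 'I_n} := [ffun x => a (g x)].
have hK : cancel (h g) (h g^-1%g) by move=> a; apply/ffunP => x; rewrite !ffunE permKV.
rewrite [RHS](reindex_inj (can_inj hK)); apply: eq_bigr => a _.
have ha : h g a =1 a \o g by move=> x; rewrite ffunE.
rewrite (eq_stabsum _ ha) stabsum_comp -scalemxAr -scalemxAl rGKV.
by rewrite -(row_coef_comp a g); congr (_ *: _); apply: eq_jt_coef => // i; apply: eq_card => x; rewrite !inE ffunE.
Qed.

Lemma row_elt_comm_stabsum (X : eqType) e (f : 'I_r -> X) :
  stabsum e f *m row_elt = row_elt *m stabsum e f.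
Proof.
rewrite /stabsum mulmx_suml mulmx_sumr; apply: eq_bigr => s _.
by rewrite -scalemxAl row_elt_comm scalemxAr.
Qed.

Definition rows_of (g : 'S_r) : {ffun 'I_r -> 'I_n} := [ffun x => tab_row (g x)].
Definition cols_of (g : 'S_r) : {ffun 'I_r -> 'I_m} := [ffun x => tab_col (g x)].

Lemma row_coef_of g : row_coef (rows_of g) = 1.
Proof.
rewrite -row_coef_tab -(row_coef_comp tab_row g); apply: eq_jt_coef => // i.
by apply: eq_card => x; rewrite !inE ffunE.
Qed.

Lemma col_coef_of g : col_coef (cols_of g) = 1.
Proof.
rewrite -col_coef_tab -(col_coef_comp tab_col g); apply: eq_jt_coef => // i.
by apply: eq_card => x; rewrite !inE ffunE.
Qed.

Lemma stabsum_rows e g : stabsum e (rows_of g) = rG g *m stabsum e tab_row *m rG g^-1%g.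
Proof. by rewrite -stabsum_comp; apply: eq_stabsum => x; rewrite ffunE. Qed.

Lemma stabsum_cols e g : stabsum e (cols_of g) = rG g *m stabsum e tab_col *m rG g^-1%g.
Proof. by rewrite -stabsum_comp; apply: eq_stabsum => x; rewrite ffunE. Qed.

(** By [stabsum_mul_neq0] only the pairs [(rows_of g, cols_of g)] contribute, each with coefficient
    1 and with product the conjugate of [c] by [g]. *)
Lemma row_col_elt : row_elt *m col_elt = conj_sum.
Proof.
pose F (p : {ffun 'I_r -> 'I_n} * {ffun 'I_r -> 'I_m}) :=
  (row_coef p.1 *: stabsum false p.1) *m (col_coef p.2 *: stabsum true p.2).
pose h g := (rows_of g, cols_of g).
have h_inj : injective h.
  move=> g g' [/ffunP eq_r /ffunP eq_c]; apply/permP => x; apply: tab_inj.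
    by have := eq_r x; rewrite !ffunE.
  by have := eq_c x; rewrite !ffunE.
transitivity (\sum_p F p).
  rewrite /row_elt /col_elt mulmx_suml -(pair_big xpredT xpredT (fun a b => F (a, b))) /=.
  by apply: eq_bigr => a _; rewrite mulmx_sumr.
rewrite (bigID (mem (h @: 'S_r))) /= [X in _ + X]big1 ?addr0.
  rewrite big_imset /= => [|g g' _ _]; last exact: h_inj.
  apply: eq_big => [g|g _]; first by rewrite inE.
  rewrite /F row_coef_of col_coef_of !scale1r stabsum_rows stabsum_cols.
  by rewrite !mulmxA (rGKV _ g).
move=> [a b] /= not_h; apply/eqP; apply: contraNT not_h.
rewrite /F /= -scalemxAl -scalemxAr scalerA scaler_eq0 negb_or mulf_eq0 negb_or -andbA.
case/and3P=> a_nz b_nz /(stabsum_mul_neq0 a_nz b_nz)[g [ag bg]].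
apply/imsetP; exists g; rewrite ?inE //.
by congr (_, _); apply/ffunP => x; rewrite ffunE ?ag ?bg.
Qed.

(** Next to [B] only the colourings [rows_of g] with [g] a column permutation survive. In
    [B g A g^-1] the first [g] is absorbed with its sign, and the signed sum of the [g^-1] rebuilds
    a factor [B]. *)
Lemma young_row_elt : c *m row_elt = c *m c.
Proof.
have h_inj : {in stab tab_col &, injective rows_of}.
  move=> g g' /stabP gB /stabP gB' /ffunP eq_r; apply/permP => x; apply: tab_inj.
    by have := eq_r x; rewrite !ffunE.
  by rewrite gB gB'.
transitivity (\sum_(a : {ffun 'I_r -> 'I_n}) c *m (row_coef a *: stabsum false a)).
  by rewrite mulmx_sumr.
rewrite (bigID (mem (rows_of @: stab tab_col))) /= [X in _ + X]big1 ?addr0.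
  rewrite big_imset //=.
  transitivity (\sum_(g in stab tab_col) c *m A *m ((-1) ^+ odd_perm g *: rG g^-1%g)).
    apply: eq_bigr => g gB; rewrite row_coef_of scale1r stabsum_rows.
    have -> : c *m (rG g *m A *m rG g^-1%g) = A *m (B *m rG g) *m A *m rG g^-1%g.
      by rewrite !mulmxA.
    by rewrite stabsum_mulr //= -!scalemxAr -!scalemxAl.
  rewrite -mulmx_sumr -[RHS]mulmxA [B *m c]mulmxA -[LHS]mulmxA -mulmxA; congr (_ *m _).
  rewrite -mulmxA; congr (_ *m (_ *m _)).
  rewrite [RHS](reindex_inj invg_inj); apply: eq_big => [g|g _]; first by rewrite stabV.
  by rewrite odd_permV.
move=> a not_h; apply/eqP; apply: contraNT not_h.
rewrite -scalemxAr scaler_eq0 negb_or => /andP[a_nz].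
rewrite -mulmxA => nz; have {nz}nz : stabsum false a *m B != 0.
  apply: contraNneq nz => E; rewrite -(stabsum_tr false a) -[B]stabsum_tr -trmx_mul E.
  by rewrite trmx0 mulmx0.
have [|g [ag bg]] := stabsum_mul_neq0 a_nz _ nz; first by rewrite col_coef_tab oner_eq0.
apply/imsetP; exists g; first by apply/stabP => x; rewrite [RHS]bg.
by apply/ffunP => x; rewrite ffunE ag.
Qed.

(** Mirror image of [young_row_elt]: in [g B g^-1 A] the factor [g^-1] is absorbed by [A], and the
    sum of the [g] rebuilds a factor [A]. *)
Lemma col_elt_young : col_elt *m c = c *m c.
Proof.
have h_inj : {in stab tab_row &, injective cols_of}.
  move=> g g' /stabP gB /stabP gB' /ffunP eq_r; apply/permP => x; apply: tab_inj.
    by rewrite gB gB'.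
  by have := eq_r x; rewrite !ffunE.
transitivity (\sum_(b : {ffun 'I_r -> 'I_m}) (col_coef b *: stabsum true b) *m c).
  by rewrite mulmx_suml.
rewrite (bigID (mem (cols_of @: stab tab_row))) /= [X in _ + X]big1 ?addr0.
  rewrite big_imset //=.
  transitivity (\sum_(g in stab tab_row) (rG g *m (B *m c))).
    apply: eq_bigr => g gA; rewrite col_coef_of scale1r stabsum_cols.
    have -> : rG g *m B *m rG g^-1%g *m c = rG g *m B *m (rG g^-1%g *m A) *m B.
      by rewrite !mulmxA.
    by rewrite (@stabsum_mull _ _ false tab_row) ?stabV // scale1r !mulmxA.
  rewrite -mulmx_suml -[RHS]mulmxA; congr (_ *m _).
  by apply: eq_bigr => g _; rewrite scale1r.
move=> b not_h; apply/eqP; apply: contraNT not_h.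
rewrite -scalemxAl scaler_eq0 negb_or => /andP[b_nz].
rewrite mulmxA => nz; have {nz}nz : A *m stabsum true b != 0.
  apply: contraNneq nz => E; rewrite -(stabsum_tr true b) -[A in _ *m A *m _]stabsum_tr -trmx_mul E.
  by rewrite trmx0 mul0mx.
have [|g [ag bg]] := stabsum_mul_neq0 _ b_nz nz; first by rewrite row_coef_tab oner_eq0.
apply/imsetP; exists g; first by apply/stabP => x; rewrite [RHS]ag.
by apply/ffunP => x; rewrite ffunE bg.
Qed.

Lemma row_eltE : row_elt =
  \sum_(s : 'S_r) (\sum_(a : {ffun 'I_r -> 'I_n} | s \in stab a) row_coef a) *: rG s.
Proof.
transitivity (\sum_(a : {ffun 'I_r -> 'I_n}) \sum_(s in stab a) row_coef a *: rG s).
  apply: eq_bigr => a _; rewrite scaler_sumr.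
  by apply: eq_bigr => s _; rewrite scale1r.
rewrite (exchange_big_dep xpredT) //=; apply: eq_bigr => s _.
by rewrite scaler_suml.
Qed.

Lemma col_eltE : col_elt =
  \sum_(s : 'S_r) ((-1) ^+ odd_perm s *
    \sum_(b : {ffun 'I_r -> 'I_m} | s \in stab b) col_coef b) *: rG s.
Proof.
transitivity (\sum_(b : {ffun 'I_r -> 'I_m}) \sum_(s in stab b)
    ((-1) ^+ odd_perm s * col_coef b) *: rG s).
  apply: eq_bigr => b _; rewrite scaler_sumr.
  by apply: eq_bigr => s _; rewrite scalerA mulrC.
rewrite (exchange_big_dep xpredT) //=; apply: eq_bigr => s _.
by rewrite mulr_sumr scaler_suml.
Qed.

End YoungSymmetrizer.

(** * The character of the Specht module as a trace *)

Section SubmoduleTrace.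
Variables (gT : finGroupType) (G : {group gT}) (n : nat).
Variables (rG : mx_representation rat G n) (U e : 'M[rat]_n).

(** With [W] a basis of [U], the projection [e] factors as [X *m W] where [W *m X = 1]; cyclicity of
    the trace does the rest. *)
Lemma submod_trace (Umod : mxmodule rG U) (x : gT) :
    x \in G -> e *m e = e -> (e :=: U)%MS ->
  \tr (submod_repr Umod x) = \tr (e *m rG x).
Proof.
move=> Gx ee eU; set W := val_submod (1%:M : 'M_(\rank U)).
have WU : (W <= U)%MS by rewrite /W val_submod1.
set X := in_submod U e.
have eX : e = X *m W by rewrite -val_submodE in_submodK // eU.
have We : W *m e = W.
  by have /submxP[Y WY] : (W <= e)%MS; rewrite ?eU // WY -mulmxA ee.
have WX : W *m X = 1%:M.
  by apply: (@val_submod_inj _ _ U); rewrite val_submodE -/W -mulmxA -eX We.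
set Z := submod_repr Umod x.
have ZW : Z *m W = W *m rG x.
  by rewrite -[Z]mul1mx -[_ *m W]val_submodE val_submodJ.
by rewrite -[Z]mulmx1 -WX mulmxA ZW mxtrace_mulC mulmxA -eX.
Qed.

End SubmoduleTrace.

Section SpechtCharacter.
Variables (r : nat) (lam : seq nat) (n m : nat).
Hypotheses (lamP : is_partition_of r lam) (le_n : (size lam <= n)%N).
Hypothesis (le_m : forall i, (nth 0 lam i <= m)%N).
Local Notation G := [set: 'S_r]%G.
Local Notation rG := (regular_repr rat G).

Let rGM (s t : 'S_r) : rG (s * t)%g = rG s *m rG t.
Proof. by rewrite repr_mxM ?inE. Qed.

Local Notation A := (stabsum false (tab_row lamP le_n)).
Local Notation B := (stabsum true (tab_col lamP le_m)).
Local Notation c := (A *m B).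
Local Notation z := (row_elt r lam n).
Local Notation y := (col_elt r lam m).

Hypothesis proportional : exists k : rat, z = k *: y.

Let c_comm : c *m z = z *m c.
Proof. by rewrite -mulmxA row_elt_comm_stabsum mulmxA row_elt_comm_stabsum mulmxA. Qed.

(** Since [z] is central, [c z = c^2] can be compared with [y c = c^2]. As [c^2] is non-zero the
    factor is 1, without computing any sign of the particle-hole duality. *)
Lemma col_elt_row_elt : y = z.
Proof.
have [h h_neq0 ch] := young_sqr lamP le_n le_m.
have [k zy] := proportional.
have := c_comm; rewrite young_row_elt [in RHS]zy -scalemxAl col_elt_young ch scalerA => /eqP.
rewrite -subr_eq0 -scalerBl scaler_eq0 (negbTE (young_neq0 _ _ _)) orbF.
rewrite subr_eq0 -{1}[h]mul1r => /eqP /(mulIf h_neq0) k1.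
by rewrite zy -k1 scale1r.
Qed.

Lemma conj_sum_row_elt : exists h : rat,
  [/\ h != 0, c *m c = h *: c & conj_sum lamP le_n le_m = h *: z].
Proof.
have [h h_neq0 ch] := young_sqr lamP le_n le_m; exists h; split=> //.
have z2 : z *m z = conj_sum lamP le_n le_m.
  by rewrite -row_col_elt col_elt_row_elt.
have z3 : z *m (z *m z) = h *: (z *m z).
  rewrite z2 /conj_sum mulmx_sumr scaler_sumr; apply: eq_bigr => g _.
  rewrite [z *m _]mulmxA [z *m (rG g *m _)]mulmxA -row_elt_comm -[_ *m z *m _]mulmxA.
  by rewrite -c_comm young_row_elt ch -scalemxAr -scalemxAl.
rewrite -z2; apply/eqP; rewrite -subr_eq0; apply/eqP/mulmx_trmx_eq0.
(* [w = z^2 - h z] is symmetric and [z w = 0], hence [w w = 0]. *)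
set w := _ - _; have -> : w^T = w.
  by rewrite /w linearB /= linearZ /= trmx_mul !row_elt_tr.
have zw : z *m w = 0 by rewrite /w mulmxBr z3 -scalemxAr subrr.
by rewrite {1}/w mulmxBl -scalemxAl -mulmxA zw mulmx0 scaler0 subrr.
Qed.

Lemma young_symmetrizerE : young_symmetrizer r lam = gring_row c.
Proof.
rewrite youngE linear_sum; apply: eq_bigr => p _.
rewrite linear_sum; apply: eq_bigr => q _.
rewrite linearZ /=; congr (_ *: _).
by rewrite /gring_row rowK gring_indexK ?inE // mul1g.
Qed.

(** Left multiplication by [c], acting on row vectors; divided by [h] it is a projection onto the
    right ideal generated by [c]. *)
Definition left_mul : 'M[rat]_(gcard G) :=
  \matrix_i (gring_row c *m rG (enum_val i)).

Lemma gring_row_left_mul s :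
  gring_row (rG s) *m left_mul = gring_row c *m rG s.
Proof.
rewrite /gring_row rowK gring_indexK ?inE // mul1g -rowE rowK.
by rewrite gring_indexK ?inE.
Qed.

Lemma left_mul_young h : c *m c = h *: c -> left_mul *m left_mul = h *: left_mul.
Proof.
move=> ch; apply/row_matrixP => i; rewrite row_mul linearZ /= !rowK -gring_row_mul.
set x := enum_val i.
have -> : gring_row (c *m rG x) *m left_mul = gring_row c *m (c *m rG x).
  rewrite !youngE !mulmx_suml linear_sum mulmx_suml mulmx_sumr.
  apply: eq_bigr => p _; rewrite !mulmx_suml linear_sum mulmx_suml mulmx_sumr.
  apply: eq_bigr => q _.
  by rewrite -scalemxAl linearZ -scalemxAl -scalemxAr -rGM gring_row_left_mul youngE.
by rewrite -gring_row_mul mulmxA ch -scalemxAl linearZ.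
Qed.

Lemma left_mul_cyclic : (left_mul :=: cyclic_mx rG (gring_row c))%MS.
Proof.
apply/eqmxP/andP; split.
  apply/row_subP => i; rewrite rowK; apply/cyclic_mxP.
  by exists (rG (enum_val i)); rewrite ?envelop_mx_id ?inE.
apply: cyclic_mx_sub.
  apply/mxmoduleP => x _; apply/row_subP => i; rewrite row_mul rowK -mulmxA -rGM.
  by rewrite -gring_row_left_mul submxMl.
by rewrite -[gring_row c]mulmx1 -(repr_mx1 rG) -gring_row_left_mul submxMl.
Qed.

Lemma specht_charE (s : 'S_r) :
  specht_char lam s = \sum_(a : {ffun 'I_r -> 'I_n} | s \in stab a) row_coef lam a.
Proof.
have [h [h_neq0 ch conj_z]] := conj_sum_row_elt.
have LL := left_mul_young ch.
pose e := h^-1 *: left_mul.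
have ee : e *m e = e.
  by rewrite /e -scalemxAl -scalemxAr LL !scalerA mulfVK.
have eU : (e :=: cyclic_mx rG (young_symmetrizer r lam))%MS.
  rewrite young_symmetrizerE; apply: eqmx_trans left_mul_cyclic.
  by apply: eqmx_scale; rewrite invr_neq0.
rewrite /specht_char (submod_trace _ _ ee eU) ?inE // /e -scalemxAl linearZ /=.
(* The diagonal entry at [g^-1] is the coefficient of [g^-1] in [c g^-1 s], that is, of [s^-1] in
   [g c g^-1]. *)
have -> : \tr (left_mul *m rG s) = conj_sum lamP le_n le_m (gring_index G 1%g) (gring_index G s^-1%g).
  rewrite /mxtrace (reindex (gring_index G)); last first.
    by exists enum_val => i _; rewrite ?gring_indexK ?gring_valK ?inE.
  rewrite summxE (reindex_inj invg_inj); apply: eq_bigr => g _.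
  have -> : (left_mul *m rG s) (gring_index G g^-1%g) (gring_index G g^-1%g)
      = (c *m rG (g^-1 * s)%g) (gring_index G 1%g) (gring_index G g^-1%g).
    transitivity (row (gring_index G g^-1%g) (left_mul *m rG s) 0 (gring_index G g^-1%g)).
      by rewrite [RHS]mxE.
    rewrite row_mul rowK gring_indexK ?inE // -!gring_row_mul rGM mulmxA.
    by rewrite [LHS]mxE.
  rewrite !youngE mulmx_suml mulmx_sumr mulmx_suml !summxE; apply: eq_bigr => p _.
  rewrite mulmx_suml mulmx_sumr mulmx_suml !summxE; apply: eq_bigr => q _.
  rewrite -scalemxAl -scalemxAr -scalemxAl -!rGM [LHS]mxE [RHS]mxE !regular_reprE.
  congr (_ * _%:R); congr nat_of_bool; rewrite !mul1g.
  rewrite -(inj_eq (mulgI g)) -(inj_eq (mulIg s^-1%g)) mulgV mul1g.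
  by rewrite !mulgA mulgK.
rewrite conj_z mxE mulrA mulVf // mul1r row_eltE summxE.
rewrite (eq_bigr (fun t => if t == s^-1%g then
    \sum_(a : {ffun 'I_r -> 'I_n} | t \in stab a) row_coef lam a else 0)) => [|t _].
  by rewrite -big_mkcond big_pred1_eq; apply: eq_bigl => a; rewrite stabV.
by rewrite mxE regular_reprE mul1g; case: eqP; rewrite ?mulr1 ?mulr0.
Qed.

Lemma specht_dimE : (specht_dim r lam)%:R = specht_char lam (1%g : 'S_r).
Proof. by rewrite /specht_char repr_mx1 mxtrace1. Qed.

End SpechtCharacter.

(** * Particles and holes *)

Section FixedColorings.
Variables (r : nat) (X : finType) (R : comPzRingType) (y : X -> R).

(** Expanding the product chooses one colour per cycle, and the colourings fixed by [s] are those
    constant on cycles. *)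
Lemma prod_porbits_sum (s : 'S_r) :
  \prod_(c in porbits s) \sum_(x : X) y x ^+ #|c|
  = \sum_(a : {ffun 'I_r -> X} | s \in stab a) \prod_(i < r) y (a i).
Proof.
pose orbT : finType := {c in porbits s}.
have orbP i : porbit s i \in porbits s by apply: imset_f.
pose orb i : orbT := Sub (porbit s i) (orbP i).
have repP (c : orbT) : exists i, orb i == c.
  by have /imsetP[i _ ci] := valP c; exists i; rewrite -val_eqE /= -ci.
pose rep c := xchoose (repP c).
have repK c : orb (rep c) = c by apply/eqP/(xchooseP (repP c)).
rewrite big_sub bigA_distr_bigA /=.
pose h (f : {ffun orbT -> X}) : {ffun 'I_r -> X} := [ffun i => f (orb i)].
pose h' (a : {ffun 'I_r -> X}) : {ffun orbT -> X} := [ffun c => a (rep c)].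
rewrite (reindex_onto h h') /=; last first.
  move=> a /stabP sa; apply/ffunP => i; rewrite !ffunE.
  have /eqP := repK (orb i); rewrite -val_eqE /= eq_porbit_mem => /porbitP[k ->].
  elim: k => [|k IH]; first by rewrite perm1.
  by rewrite expgSr permM sa.
apply: eq_big => [f|f _].
  apply/esym/andP; split; last first.
    by apply/eqP/ffunP => c; rewrite !ffunE repK.
  apply/stabP => i; rewrite !ffunE; congr (f _); apply: val_inj => /=.
  by have := porbit_perm s 1 i; rewrite expg1.
rewrite (partition_big orb xpredT) //; apply: eq_bigr => c _.
rewrite (eq_bigr (fun=> y (f c))) => [|i /eqP <-]; last by rewrite ffunE.
rewrite prodr_const; congr (_ ^+ _); have /imsetP[k _ ck] := valP c.
apply: eq_card => i; transitivity (porbit s i == val c); last by [].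
by rewrite ck eq_porbit_mem -ck.
Qed.

End FixedColorings.

Section Hops.

Definition rho_mnm n (i : 'I_n) : nat := n.-1 - i.

Definition alternant n : {mpoly rat[n]} :=
  \det (\matrix_(i < n, j < n) 'X_i ^+ rho_mnm j).

Definition power_sum n l : {mpoly rat[n]} := \sum_(i < n) 'X_i ^+ l.

(* Signed count of the ways to move particles from [v] to the ground state by
   hops of lengths [ls]: the exponents of an alternating monomial are the
   positions of fermions on a line. *)
Definition hop n (ls : seq nat) (v : 'X_{1..n}) : rat :=
  (alternant n * \prod_(l <- ls) power_sum n l)@_v.

Lemma mcoeffMX_cond n (p : {mpoly rat[n]}) (m k : 'X_{1..n}) :
  (p * 'X_[m])@_k = if (m <= k)%MM then p@_(k - m)%MM else 0.
Proof.
case: ifPn => [le_mk|]; first by rewrite -{1}(submK le_mk) addmC mcoeffMX.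
apply: contraNeq; rewrite -mcoeff_msupp (perm_mem (msuppMX p m)).
by case/mapP=> m' _ ->; apply/mnm_lepP => i; rewrite mnmDE leq_addr.
Qed.

Lemma prodr_forall (R : pzSemiRingType) n (b : 'I_n -> bool) :
  \prod_(i < n) (b i)%:R = [forall i, b i]%:R :> R.
Proof.
have -> : [forall i, b i] = \big[andb/true]_i b i by rewrite big_andE.
apply/esym/(big_morph (fun c : bool => c%:R)) => // c d.
by rewrite -natrM mulnb.
Qed.

(** For [v = lam + rho] this determinant is [jt_coef lam c]. *)
Lemma mcoeff_alternantM n (c v : 'X_{1..n}) :
  (alternant n * 'X_[c])@_v = \det (\matrix_(i < n, j < n) (v i == c i + rho_mnm j)%N%:R).
Proof.
rewrite /alternant /determinant mulr_suml raddf_sum; apply: eq_bigr => s _ /=.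
have -> : \prod_i (\matrix_(i, j) 'X_i ^+ rho_mnm j) i (s i)
    = 'X_[[multinom rho_mnm (s i) | i < n]] :> {mpoly rat[n]}.
  by rewrite mpolyXE_id; apply: eq_bigr => i _; rewrite mxE mnmE.
rewrite -mulrA -mpolyXD !mulr_sign.
have -> : \prod_i (\matrix_(i, j) (v i == c i + rho_mnm j)%N%:R) i (s i) =
    ('X_[[multinom rho_mnm (s i) | i < n] + c] : {mpoly rat[n]})@_v.
  rewrite mcoeffX; under eq_bigr do rewrite mxE.
  rewrite prodr_forall; congr (nat_of_bool _)%:R.
  apply/forallP/eqP => [H|<- i]; last by rewrite mnmDE mnmE addnC.
  by apply/mnmP => i; rewrite mnmDE mnmE addnC; apply/esym/eqP.
by case: ifP => // _; rewrite raddfN.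
Qed.

Lemma hop_nil n (v : 'X_{1..n}) :
  hop [::] v = \det (\matrix_(i < n, j < n) (v i == rho_mnm j)%N%:R).
Proof.
rewrite /hop big_nil -mpolyX0 mcoeff_alternantM; congr (\det _).
by apply/matrixP => i j; rewrite !mxE mnm0E.
Qed.

Lemma hop_cons n l ls (v : 'X_{1..n}) :
  hop (l :: ls) v = \sum_(i < n) if (l <= v i)%N then hop ls (v - U_(i) *+ l)%MM else 0.
Proof.
rewrite /hop big_cons mulrCA mulrC mulr_sumr raddf_sum; apply: eq_bigr => i _ /=.
rewrite mpolyXn mcoeffMX_cond; congr (if _ then _ else _).
apply/mnm_lepP/idP => [/(_ i)|le_l j]; first by rewrite mulmnE mnm1E eqxx mul1n.
by rewrite mulmnE mnm1E; case: eqP => [<-|]; rewrite ?mul1n ?mul0n.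
Qed.

Lemma msymXU n (s : 'S_n) i : msym s 'X_i = 'X_(s i) :> {mpoly rat[n]}.
Proof.
rewrite msymX; congr 'X_[_]; apply/mnmP => j; rewrite mnmE !mnm1E.
by congr nat_of_bool; apply/eqP/eqP => [->|<-]; rewrite ?permKV ?permK.
Qed.

Lemma msym_power_sum n (s : 'S_n) l : msym s (power_sum n l) = power_sum n l.
Proof.
rewrite /power_sum raddf_sum /= [RHS](reindex_inj (@perm_inj _ s)).
by apply: eq_bigr => i _; rewrite rmorphXn /= msymXU.
Qed.

Lemma msym_alternant n (s : 'S_n) : msym s (alternant n) = (-1) ^+ s * alternant n.
Proof.
rewrite /alternant -det_map_mx -det_perm -det_mulmx -row_permE.
congr (\det _); apply/matrixP => i j.
by rewrite !mxE rmorphXn /= msymXU.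
Qed.

(** Pauli exclusion: the polynomial changes sign under the swap of [i] and [j], which fixes [v]. *)
Lemma hop_eq0 n ls (v : 'X_{1..n}) i j : i != j -> v i = v j -> hop ls v = 0.
Proof.
move=> ne_ij eq_v; set t := tperm i j.
have vt : [multinom v (t k) | k < n] = v.
  by apply/mnmP => k; rewrite mnmE /t; case: tpermP => [->|->|].
set q := alternant n * \prod_(l <- ls) power_sum n l.
have qt : msym t q = - q.
  rewrite /q msymM msym_alternant odd_tperm ne_ij mulN1r mulNr rmorph_prod /=.
  by under eq_bigr do rewrite msym_power_sum.
have := congr1 (mcoeff v) qt; rewrite mcoeff_sym vt mcoeffN => /eqP.
by rewrite -addr_eq0 -mulr2n mulrn_eq0 => /eqP.
Qed.

Section Duality.
Variables n m : nat.
Local Notation N := (n + m)%N.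
Implicit Type p : 'S_N.

(** [p] puts labels on the sites [0, ..., N - 1]: the first [n] labels are particles, the others
    holes. Holes are read from the far end, so that a particle hopping down onto a hole lowers both
    exponents by the same length. *)
Definition particles p : 'X_{1..n} := [multinom (p (lshift m i) : nat) | i < n].
Definition holes p : 'X_{1..m} := [multinom N.-1 - p (rshift n j) | j < m]%N.

(** A hop onto an occupied site vanishes by [hop_eq0]; otherwise the target is a hole and the hop
    exchanges two labels. The index set is the one of [hop_holes_cons]. *)
Lemma hop_particles_cons l ls p : (0 < l)%N -> hop (l :: ls) (particles p) =
  \sum_(i < n) \sum_(j < m | p (lshift m i) == (p (rshift n j) + l)%N :> nat)
    hop ls (particles (tperm (lshift m i) (rshift n j) * p)%g).
Proof.
move=> l_gt0; rewrite hop_cons; apply: eq_bigr => i _; rewrite mnmE.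
case: ifP => [le_l|]; last first.
  by move=> gt_l; rewrite big_pred0 // => j; apply/eqP => E; move: gt_l; rewrite E leq_addl.
have lt_k : (p (lshift m i) - l < N)%N by rewrite (leq_ltn_trans (leq_subr _ _)).
set x := p^-1%g (Ordinal lt_k).
have px : p x = (p (lshift m i) - l)%N :> nat by rewrite permKV.
case: (split_ordP x) => [i' xE | j xE].
  rewrite big_pred0 => [|j].
    apply: (@hop_eq0 _ _ _ i i'); rewrite ?mnmBE ?mulmnE ?mnm1E ?mnmE ?eqxx.
      by apply/eqP => E; move: px; rewrite xE -E; lia.
    by rewrite -xE px; case: eqP => [E|]; [move: px; rewrite xE -E; lia | lia].
  apply/negP => /eqP E; have : p (rshift n j) = p x by apply: val_inj; rewrite /= px; lia.
  by move/perm_inj; rewrite xE => /eqP; rewrite eq_rlshift.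
rewrite (big_pred1 j) => [|k].
  congr (hop _ _); apply/mnmP => k; rewrite mnmBE mulmnE mnm1E !mnmE permM.
  have [<-|ne_ik] := eqVneq i k; first by rewrite tpermL -xE px mul1n.
  by rewrite tpermD ?mul0n ?subn0 // ?(inj_eq (@lshift_inj _ _)) // eq_rlshift.
apply/eqP/eqP => [E|->]; last by rewrite -xE px; lia.
have : p (rshift n k) = p x by apply: val_inj; rewrite /= px; lia.
by move/perm_inj; rewrite xE => /rshift_inj.
Qed.

Lemma hop_holes_cons l ls p : (0 < l)%N -> hop (l :: ls) (holes p) =
  \sum_(i < n) \sum_(j < m | p (lshift m i) == (p (rshift n j) + l)%N :> nat)
    hop ls (holes (tperm (lshift m i) (rshift n j) * p)%g).
Proof.
move=> l_gt0; rewrite hop_cons (exchange_big_dep xpredT) //=.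
apply: eq_bigr => j _; rewrite mnmE.
have lt_N k : (p k < N)%N by [].
have lt_j := lt_N (rshift n j).
case: ifP => [le_l|]; last first.
  move=> gt_l; rewrite big_pred0 // => i; apply/eqP => E; move: gt_l.
  by have := lt_N (lshift m i); lia.
have lt_k : (p (rshift n j) + l < N)%N by lia.
set x := p^-1%g (Ordinal lt_k).
have px : p x = (p (rshift n j) + l)%N :> nat by rewrite permKV.
case: (split_ordP x) => [i xE | j' xE].
  rewrite (big_pred1 i) => [|k].
    congr (hop _ _); apply/mnmP => k; rewrite mnmBE mulmnE mnm1E !mnmE permM.
    have [<-|ne_jk] := eqVneq j k; first by rewrite tpermR -xE px; lia.
    by rewrite tpermD ?mul0n ?subn0 // ?(inj_eq (@rshift_inj _ _)) // eq_lrshift.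
  apply/eqP/eqP => [E|->]; last by rewrite -xE px.
  have : p (lshift m k) = p x by apply: val_inj; rewrite /= px; lia.
  by move/perm_inj; rewrite xE => /lshift_inj.
rewrite big_pred0 => [|i].
  apply: (@hop_eq0 _ _ _ j j'); rewrite ?mnmBE ?mulmnE ?mnm1E ?mnmE ?eqxx.
    by apply/eqP => E; move: px; rewrite xE -E; lia.
  by rewrite -xE px; case: eqP => [E|]; [move: px; rewrite xE -E; lia | lia].
apply/negP => /eqP E; have : p (lshift m i) = p x by apply: val_inj; rewrite /= px; lia.
by move/perm_inj; rewrite xE => /eqP; rewrite eq_lrshift.
Qed.

End Duality.
End Hops.

Section PermutationBlocks.
Variables n m : nat.
Local Notation N := (n + m)%N.
Variable p : 'S_N.

Let M : 'M[rat]_N := perm_mx p.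
(** Complementary minors of an orthogonal matrix. Either the upper right block is zero and the upper
    left one has determinant 1 or -1, or both diagonal blocks contain a zero row. *)
Lemma det_perm_blocks : \det (ulsubmx M) = (-1) ^+ p * \det (drsubmx M).
Proof.
have detM : \det M = (-1) ^+ p by rewrite det_perm.
have [ur0|ur_nz] := eqVneq (ursubmx M) 0.
  have dd : \det (ulsubmx M) * \det (drsubmx M) = (-1) ^+ p.
    by rewrite -detM -[in RHS](submxK M) ur0 det_lblock.
  have MMt : M *m M^T = 1%:M by rewrite tr_perm_mx -perm_mxM mulgV perm_mx1.
  have UU : ulsubmx M *m (ulsubmx M)^T = 1%:M.
    have := congr1 ulsubmx MMt; rewrite -[in LHS](submxK M) tr_block_mx mulmx_block.
    by rewrite scalar_mx_block !block_mxKul ur0 mul0mx addr0.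
  have u2 : \det (ulsubmx M) * \det (ulsubmx M) = 1.
    by rewrite -{2}det_tr -det_mulmx UU det1.
  have D : \det (drsubmx M) = \det (ulsubmx M) * (-1) ^+ p by rewrite -dd mulrA u2 mul1r.
  by rewrite D mulrCA -signr_addb addbb mulr1.
have u0 : \det (ulsubmx M) = 0.
  have /matrix0Pn[i [j ne0]] := ur_nz.
  have pij : p (lshift m i) = rshift n j.
    by apply/eqP; move: ne0; rewrite !mxE pnatr_eq0 eqb0 negbK.
  rewrite (expand_det_row _ i) big1 // => k _.
  by rewrite !mxE pij eq_rlshift mul0r.
have [dl0|dl_nz] := eqVneq (dlsubmx M) 0.
  have : \det M = 0 by rewrite -(submxK M) dl0 det_ublock u0 mul0r.
  by move/eqP; rewrite detM signr_eq0.
have -> : \det (drsubmx M) = 0; last by rewrite u0 mulr0.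
have /matrix0Pn[i [j ne0]] := dl_nz.
have pij : p (rshift n i) = lshift m j.
  by apply/eqP; move: ne0; rewrite !mxE pnatr_eq0 eqb0 negbK.
rewrite (expand_det_row _ i) big1 // => k _.
by rewrite !mxE pij eq_lrshift mul0r.
Qed.

End PermutationBlocks.

(** The ground state lists the sites of the particles in decreasing order; the determinant is the
    sign of that reversal. *)
Definition rev_mx n : 'M[rat]_n := \matrix_(i, j) (i == rho_mnm j :> nat)%:R.

Lemma hop_nil_particles n m (p : 'S_(n + m)) :
  hop [::] (particles p) = \det (rev_mx n) * (-1) ^+ p * hop [::] (holes p).
Proof.
rewrite !hop_nil.
have -> : \matrix_(i < n, j < n) (particles p i == rho_mnm j)%N%:R
    = ulsubmx (perm_mx p) *m rev_mx n.
  apply/matrixP => i j; rewrite !mxE mnmE.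
  have lt_j : (rho_mnm j < n)%N by rewrite /rho_mnm; have := ltn_ord j; lia.
  rewrite (bigD1 (Ordinal lt_j)) //= !mxE eqxx mulr1 big1 ?addr0 => [|k ne_k].
    by [].
  rewrite !mxE (_ : (k == rho_mnm j :> nat) = false) ?mulr0 //.
  exact: negbTE ne_k.
rewrite det_mulmx det_perm_blocks mulrC mulrA; congr (_ * _).
congr (\det _); apply/matrixP => i j; rewrite !mxE mnmE; congr (_%:R); congr nat_of_bool.
rewrite -val_eqE /= /rho_mnm; apply/eqP/eqP; have := ltn_ord (p (rshift n i)); have := ltn_ord j; lia.
Qed.

(** Both recursions run over the same exchanges, and each exchange flips the sign of [p]: one factor
    -1 per hop. *)
Lemma hop_particles_holes n m ls (p : 'S_(n + m)) : all (leq 1) ls ->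
  hop ls (particles p)
  = \det (rev_mx n) * (-1) ^+ p * (-1) ^+ size ls * hop ls (holes p).
Proof.
elim: ls p => [|l ls IH] p /=; first by rewrite hop_nil_particles mulr1.
case/andP=> l_gt0 ls_gt0; rewrite hop_particles_cons // hop_holes_cons //.
rewrite mulr_sumr; apply: eq_bigr => i _; rewrite mulr_sumr; apply: eq_bigr => j _.
rewrite IH // odd_permM odd_tperm eq_lrshift addTb signrN exprS.
by rewrite mulN1r !(mulrN, mulNr).
Qed.

Section ConjugatePermutation.
Local Open Scope nat_scope.
Variables (r : nat) (lam : seq nat) (n m : nat).
Hypotheses (lamP : is_partition_of r lam) (le_n : size lam <= n).
Hypothesis (le_m : forall i, nth 0 lam i <= m).

Lemma conj_perm : exists p : 'S_(n + m),
  particles p = [multinom nth 0 lam i + rho_mnm i | i < n]%N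
  /\ holes p = [multinom conj_row lam j + rho_mnm j | j < m]%N.
Proof.
have lam_s := partition_sorted lamP.
have col_le j : (conj_row lam j <= n)%N.
  by rewrite (leq_trans _ le_n) // leqNgt conj_rowP // nth_default.
pose f (x : 'I_(n + m)) : nat := match split x with
  | inl i => nth 0 lam i + rho_mnm i | inr j => n + j - conj_row lam j end.
have f_lt x : (f x < n + m)%N.
  rewrite /f /rho_mnm; case: split => [i|j]; last by have := ltn_ord j; lia.
  by have := ltn_ord i; have := le_m i; lia.
have mono_row i i' : (i < i')%N -> (nth 0 lam i' <= nth 0 lam i)%N.
  by move/ltnW; apply: nth_sorted_geq.
have mono_col j j' : (j < j')%N -> (conj_row lam j' <= conj_row lam j)%N.
  move=> lt_jj'; rewrite leqNgt; apply/negP; rewrite conj_rowP // => lt1.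
  have := ltnn (conj_row lam j); rewrite conj_rowP // => /negbT.
  by rewrite (leq_ltn_trans (ltnW lt_jj')).
(* The particle is above the hole exactly when the cell [(i, j)] lies in the diagram. *)
have crossing i j : (i < n)%N -> (nth 0 lam i + n.-1 - i != n + j - conj_row lam j)%N.
  move=> lt_in; have := conj_rowP i j lam_s; have := col_le j.
  by case: ltnP; case: ltnP => //; lia.
have f_inj : injective (fun x => Ordinal (f_lt x)).
  move=> x y /(congr1 val) /=; rewrite /f /rho_mnm.
  case: (split_ordP x) => [i ->|j ->]; case: (split_ordP y) => [i' ->|j' ->].
  - move=> E; congr lshift; apply: val_inj => /=.
    have := ltn_ord i; have := ltn_ord i'; have := mono_row i i'; have := mono_row i' i.
    by case: (ltngtP i i'); lia.
  - by have := crossing i j' (ltn_ord i); have := ltn_ord i; move=> ? ? E; lia.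
  - by have := crossing i' j (ltn_ord i'); have := ltn_ord i'; move=> ? ? E; lia.
  move=> E; congr rshift; apply: val_inj => /=.
  have := mono_col j j'; have := mono_col j' j; have := col_le j; have := col_le j'.
  by case: (ltngtP j j'); lia.
exists (perm f_inj); split; apply/mnmP => k; rewrite !mnmE permE /= /f /rho_mnm.
  by rewrite (unsplitK (inl k)).
rewrite (unsplitK (inr k)) /rho_mnm.
by have := ltn_ord k; have := col_le k; lia.
Qed.

End ConjugatePermutation.

Section RowColumn.
Variables (r : nat) (lam : seq nat) (n m : nat).
Hypotheses (lamP : is_partition_of r lam) (le_n : (size lam <= n)%N).
Hypothesis (le_m : forall i, (nth 0 lam i <= m)%N).

Lemma sum_jt_coef_hop k (c : nat -> nat) (s : 'S_r) :
  \sum_(a : {ffun 'I_r -> 'I_k} | s \in stab a) jt_coef c (fiber_card a)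
  = hop [seq #|pred_of_set o| | o <- enum (porbits s)] [multinom c i + rho_mnm i | i < k]%N.
Proof.
rewrite /hop big_map big_enum /= prod_porbits_sum mulr_sumr raddf_sum /=.
apply: eq_bigr => a _.
have -> : \prod_(i < r) 'X_(a i) = 'X_[[multinom fiber_card a i | i < k]] :> {mpoly rat[k]}.
  rewrite mpolyXE_id (partition_big a xpredT) //=; apply: eq_bigr => i _.
  rewrite mnmE (eq_bigr (fun=> 'X_i)) => [|x /eqP-> //].
  by rewrite prodr_const; congr (_ ^+ _); apply: eq_card => x; rewrite !inE.
rewrite mcoeff_alternantM; congr (\det _); apply/matrixP => i j; rewrite !mxE !mnmE.
congr (_%:R); congr nat_of_bool; rewrite /rho_mnm.
by have := ltn_ord i; have := ltn_ord j; lia.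
Qed.

(** The duality gives one factor -1 per cycle of [s]; up to the parity of [r] this is the sign of
    [s] that appears in [col_elt]. *)
Lemma row_elt_proportional : exists k : rat, row_elt r lam n = k *: col_elt r lam m.
Proof.
have [p [pE hE]] := conj_perm lamP le_n le_m.
exists (\det (rev_mx n) * (-1) ^+ p * (-1) ^+ odd r).
rewrite col_eltE row_eltE scaler_sumr; apply: eq_bigr => s _; rewrite scalerA.
congr (_ *: _); rewrite !sum_jt_coef_hop -pE -hE hop_particles_holes.
  rewrite size_map -cardE !mulrA; congr (_ * _); rewrite -!mulrA; congr (_ * (_ * _)).
  by rewrite -signr_odd /odd_perm card_ord -signr_addb addKb.
apply/allP => l /mapP[o]; rewrite mem_enum => /imsetP[x _ ->] ->.
by rewrite lt0n card_porbit_neq0.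
Qed.

End RowColumn.

(** * Characters and cycle sums *)

Section ConjugatePartition.
Local Open Scope nat_scope.
Variables (r : nat) (lam : seq nat).
Hypothesis lamP : is_partition_of r lam.

Lemma nth_le_head i : nth 0 lam i <= head 0 lam.
Proof. by rewrite -nth0; apply: nth_sorted_geq => //; apply: partition_sorted lamP. Qed.

Lemma sumn_conj_part : sumn (conj_part lam) = r.
Proof.
have lam_s := partition_sorted lamP.
rewrite -(@sum_nth_sumn _ (head 0 lam)) ?size_mkseq //.
under eq_bigr do rewrite nth_conj_part //.
rewrite sum_conj_row -(partition_sumn lamP) -(sum_nth_sumn (leqnn _)).
by apply: eq_bigr => i _; apply/minn_idPl/nth_le_head.
Qed.

Lemma conj_part_partition : is_partition_of r (conj_part lam).
Proof.
have lam_s := partition_sorted lamP.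
apply/and3P; split; last by rewrite sumn_conj_part.
  apply/(sortedP 0) => i; rewrite size_mkseq => lt_i; rewrite !nth_conj_part //=.
  rewrite leqNgt; apply/negP; rewrite conj_rowP // => lt1.
  have := ltnn (conj_row lam i); rewrite conj_rowP // => /negbT.
  by rewrite (ltn_trans (ltnSn i)).
apply/negP => /(nthP 0)[j]; rewrite size_mkseq => lt_j; rewrite nth_conj_part // => j0.
by have := conj_rowP 0 j lam_s; rewrite j0 nth0 lt_j.
Qed.

End ConjugatePartition.

Section Characters.
Variables (r : nat) (lam : seq nat).
Hypothesis lamP : is_partition_of r lam.

Lemma specht_char_jt n (s : 'S_r) : (size lam <= n)%N ->
  specht_char lam s
  = \sum_(a : {ffun 'I_r -> 'I_n} | s \in stab a) jt_coef (nth 0%N lam) (fiber_card a).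
Proof.
move=> le_n; have le_m := nth_le_head lamP.
exact: specht_charE lamP le_n le_m (row_elt_proportional lamP le_n le_m) s.
Qed.


End Characters.

Section CharacterConjugate.
Variables (r : nat) (lam : seq nat).
Hypothesis lamP : is_partition_of r lam.

(** Compare the coefficients of [s] in [col_elt = row_elt]: the column side is the sign of [s] times
    the Jacobi-Trudi class function of the conjugate. *)
Lemma specht_char_conj (s : 'S_r) :
  specht_char (conj_part lam) s = (-1) ^+ odd_perm s * specht_char lam s.
Proof.
have le_m := nth_le_head lamP; have lam_s := partition_sorted lamP.
have := col_elt_row_elt lamP (leqnn _) le_m (row_elt_proportional lamP (leqnn _) le_m).
have coefE (F : 'S_r -> rat) : (\sum_t F t *: regular_repr rat [set: 'S_r]%G t)
    (gring_index [set: 'S_r]%G 1%g) (gring_index [set: 'S_r]%G s) = F s.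
  rewrite summxE (eq_bigr (fun t => if t == s then F t else 0)) => [|t _].
    by rewrite -big_mkcond big_pred1_eq.
  by rewrite mxE regular_reprE mul1g; case: eqP; rewrite ?mulr1 ?mulr0.
rewrite row_eltE col_eltE => /matrixP/(_ (gring_index [set: 'S_r]%G 1%g) (gring_index [set: 'S_r]%G s)).
rewrite !coefE -(specht_char_jt lamP _ (leqnn _)) => <-.
rewrite mulrA -signr_addb addbb mul1r.
rewrite (specht_char_jt (n := head 0%N lam) (conj_part_partition lamP)) ?size_mkseq //.
apply: eq_bigr => a _; apply: eq_jt_coef => // j.
exact: nth_conj_part.
Qed.

End CharacterConjugate.

Section Burnside.
Variables (r : nat) (X : finType) (R : pzRingType).

Definition content (g : {ffun 'I_r -> X}) : {ffun X -> 'I_r.+1} :=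
  [ffun x => inord #|[set i | g i == x]|].

Lemma contentE g x : content g x = #|[set i | g i == x]| :> nat.
Proof. by rewrite ffunE inordK // ltnS (leq_trans (max_card _)) // card_ord. Qed.

Lemma content_comp (g : {ffun 'I_r -> X}) (s : 'S_r) : content [ffun i => g (s i)] = content g.
Proof.
apply/ffunP => x; apply: val_inj; rewrite /= !contentE.
rewrite -[LHS](card_imset _ (@perm_inj _ s)); apply: eq_card => i.
rewrite inE; apply/imsetP/eqP => [[j]|gi].
  by rewrite inE ffunE => /eqP gj ->.
by exists (s^-1 i)%g; rewrite ?inE ?ffunE permKV ?gi.
Qed.

Lemma sum_content g : (\sum_x content g x = r)%N.
Proof.
rewrite -[RHS](card_ord r) -sum1_card (partition_big g xpredT) //=.
apply: eq_bigr => x _; rewrite contentE -sum1_card.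
by apply: eq_bigl => i; rewrite inE.
Qed.

Lemma content_inj (g g' : {ffun 'I_r -> X}) : content g = content g' ->
  exists s : 'S_r, g' = [ffun i => g (s i)].
Proof.
move=> eq_c; have /tuple_permP[s sE] : perm_eq [tuple g' i | i < r] [tuple g i | i < r].
  apply/allP => x _ /=.
  have cE (f : {ffun 'I_r -> X}) : count_mem x [tuple f i | i < r] = content f x.
    rewrite contentE /= count_map cardE [in RHS]/enum_mem size_filter -enumT.
    by apply: eq_count => i; rewrite /= inE.
  by rewrite !cE eq_c.
exists s; apply/ffunP => i; rewrite ffunE.
have /(congr1 (fun t => tnth t i)) := val_inj sE.
by rewrite !tnth_mktuple.
Qed.

Lemma content_surj (M : {ffun X -> 'I_r.+1}) :
  (\sum_x M x = r)%N -> exists g, content g = M.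
Proof.
move=> sumM; pose t := flatten [seq nseq (M x) x | x <- enum X].
have size_t : size t == r.
  apply/eqP; rewrite size_flatten /shape -map_comp sumnE big_map big_enum -[RHS]sumM.
  by apply: eq_big => // x _; rewrite /= size_nseq.
pose g := [ffun i => tnth (Tuple size_t) i].
exists g; apply/ffunP => x; apply: val_inj; rewrite /= contentE.
transitivity (count_mem x t).
  have -> : t = [seq g i | i <- enum 'I_r].
    rewrite -[LHS]/(tval (Tuple size_t)) -[LHS]map_tnth_enum.
    by apply: eq_map => i; rewrite ffunE.
  rewrite count_map cardE [in LHS]/enum_mem size_filter -enumT.
  by apply: eq_count => i; rewrite /= inE.
rewrite count_flatten -map_comp sumnE big_map big_enum /= (bigD1 x) //=.
rewrite count_nseq /= eqxx mul1n big1 ?addn0 // => y ne_yx.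
by rewrite count_nseq /= (negbTE ne_yx).
Qed.

(** The colourings of content [M] form one orbit under ['S_r], and the fibres of the orbit map [F]
    are cosets of stabilisers. *)
Lemma card_content (M : {ffun X -> 'I_r.+1}) : (\sum_x M x = r)%N ->
  (\sum_(g | content g == M) #|stab g| = r`!)%N.
Proof.
move=> /content_surj[g0 g0M].
pose F (s : 'S_r) : {ffun 'I_r -> X} := [ffun i => g0 (s i)].
rewrite -(card_Sn r) -sum1_card (partition_big F (fun g => content g == M)); last first.
  by move=> s _; rewrite content_comp g0M.
apply: eq_bigr => g /eqP gM; rewrite sum1_card.
have [s0 s0E] : exists s, g = F s by apply: content_inj; rewrite g0M.
rewrite -[LHS](card_imset _ (mulIg s0)); apply: eq_card => s.
transitivity (F s == g); last by [].
apply/imsetP/eqP => [[t /stabP tg ->]|sE].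
  by apply/ffunP => i; rewrite ffunE permM -[RHS]tg s0E ffunE.
exists (s * s0^-1)%g; rewrite ?mulgKV //.
by apply/stabP => i; rewrite {1}s0E ffunE permM permKV -sE ffunE.
Qed.

Lemma sum_fixed_colorings (F : {ffun X -> 'I_r.+1} -> R) :
  \sum_(s : 'S_r) \sum_(g : {ffun 'I_r -> X} | s \in stab g) F (content g)
  = r`!%:R * \sum_(M : {ffun X -> 'I_r.+1} | (\sum_x M x == r)%N) F M.
Proof.
rewrite (exchange_big_dep xpredT) //=.
rewrite (partition_big content (fun M => \sum_x M x == r)%N) /=; last first.
  by move=> g _; rewrite sum_content.
rewrite mulr_sumr; apply: eq_bigr => M /eqP sumM.
rewrite -(card_content sumM) natr_sum mulr_suml; apply: eq_bigr => g /eqP ->.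
by rewrite mulr_natl -sumr_const; apply: eq_bigl => s.
Qed.

End Burnside.

(** * Jacobi-Trudi determinants and the Frobenius formula *)

Section JacobiTrudi.
Variable R : comNzRingType.

(** The guard is the convention [h_k = 0] for negative [k], where truncated subtraction would give
    [h 0]. *)
Definition jt_mx n (lam : nat -> nat) (h : nat -> R) : 'M[R]_n :=
  \matrix_(i < n, j < n) if (i <= lam i + j)%N then h (lam i + j - i)%N else 0.

Lemma sum_jt_index n (lam : nat -> nat) (w : 'S_n) :
    (forall i : 'I_n, (i <= lam i + w i)%N) ->
  (\sum_(j < n) (lam j + w j - j) = \sum_(j < n) lam j)%N.
Proof.
move=> le_w; apply/eqP; rewrite -(eqn_add2r (\sum_(j < n) j)) -!big_split /=.
rewrite (eq_bigr (fun j : 'I_n => lam j + w j)%N) => [|j _]; last by rewrite subnK.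
rewrite [X in X == _]big_split [X in _ == X]big_split /= eqn_add2l.
by rewrite [X in _ == X](reindex_inj (@perm_inj _ w)).
Qed.

(* Only the values of [h] up to the size of [lam] matter, as the indices in each
   term of the expansion add up to that size. *)
Lemma det_jt_mx_ext n (lam : nat -> nat) (h h' : nat -> R) :
    (forall k, (k <= \sum_(i < n) lam i)%N -> h k = h' k) ->
  \det (jt_mx n lam h) = \det (jt_mx n lam h').
Proof.
move=> eq_h; apply: eq_bigr => w _; congr (_ * _).
have [/forallP le_w|/forallPn[i lt_w]] := boolP [forall i : 'I_n, (i <= lam i + w i)%N].
  apply: eq_bigr => i _; rewrite !mxE le_w; apply: eq_h.
  by rewrite -(sum_jt_index le_w) (bigD1 i) //= leq_addr.
by rewrite !(bigD1 (P := xpredT) i) //= !mxE (negbTE lt_w) !mul0r.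
Qed.

Lemma prod_poly_coef (Y : finType) (y : Y -> R) B k :
  (\prod_(j : Y) \poly_(i < B) y j ^+ i)`_k
  = \sum_(M : {ffun Y -> 'I_B} | (\sum_j M j == k)%N) \prod_j y j ^+ M j.
Proof.
under eq_bigr do rewrite poly_def.
rewrite bigA_distr_bigA coef_sum [RHS]big_mkcond; apply: eq_bigr => M _ /=.
have -> : \prod_j (y j ^+ M j *: 'X^(M j)) = (\prod_j y j ^+ M j) *: 'X^(\sum_j M j).
  by rewrite scaler_prod prodrXr.
by rewrite coefZ coefXn eq_sym; case: eqP; rewrite ?mulr1 ?mulr0.
Qed.

Variable emb : {rmorphism rat -> R}.

(** The fixed colourings from the character and those from the power sums combine into fixed
    colourings by pairs. Burnside counting leaves a sum over contents [M], matrices indexed by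
    ['I_n] and [Y], whose rows separate once the determinant is expanded. Up to degree [r] the
    truncated geometric series give the complete homogeneous polynomials. *)
Lemma frobenius_formula r lam n (Y : finType) (y : Y -> R) :
    is_partition_of r lam -> (size lam <= n)%N ->
  \sum_(s : 'S_r) emb (specht_char lam s) * \prod_(c in porbits s) \sum_(j : Y) y j ^+ #|c|
  = r`!%:R * \det (jt_mx n (nth 0%N lam)
                    (fun k => (\prod_(j : Y) \poly_(i < r.+1) y j ^+ i)`_k)).
Proof.
move=> lamP le_n; set h := (X in jt_mx _ _ X).
pose rows (M : {ffun 'I_n * Y -> 'I_r.+1}) (i : 'I_n) : nat := (\sum_j M (i, j))%N.
pose F (M : {ffun 'I_n * Y -> 'I_r.+1}) : R :=
  emb (jt_coef (nth 0%N lam) (rows M)) * \prod_(x : 'I_n * Y) y x.2 ^+ M x.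
transitivity (\sum_(s : 'S_r) \sum_(g : {ffun 'I_r -> 'I_n * Y} | s \in stab g) F (content g)).
  apply: eq_bigr => s _; rewrite (specht_char_jt lamP _ le_n) prod_porbits_sum.
  rewrite rmorph_sum mulr_suml; under eq_bigr do rewrite mulr_sumr.
  rewrite pair_big /=.
  pose f (p : {ffun 'I_r -> 'I_n} * {ffun 'I_r -> Y}) : {ffun 'I_r -> 'I_n * Y} :=
    [ffun x => (p.1 x, p.2 x)].
  pose f' (g : {ffun 'I_r -> 'I_n * Y}) : {ffun 'I_r -> 'I_n} * {ffun 'I_r -> Y} :=
    ([ffun x => (g x).1], [ffun x => (g x).2]).
  rewrite [RHS](reindex_onto f f') => [|g _]; last first.
    by apply/ffunP => x; rewrite !ffunE -surjective_pairing.
  apply: eq_big => [[a e]|[a e] /= _].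
    rewrite /=; apply/andP/andP => [[/stabP sa /stabP se]|[/stabP sg _]].
      split; first by apply/stabP => x; rewrite !ffunE /= sa se.
      by apply/eqP; congr (_, _); apply/ffunP => x; rewrite !ffunE.
    by split; apply/stabP => x; have := sg x; rewrite !ffunE /= => -[].
  rewrite /F; congr (emb _ * _).
    apply: eq_jt_coef => // i; rewrite /rows /fiber_card -sum1_card.
    rewrite (partition_big e xpredT) //=; apply: eq_bigr => j _.
    rewrite contentE -sum1_card; apply: eq_bigl => x.
    by rewrite !inE ffunE.
  rewrite (partition_big (f (a, e)) xpredT) //=; apply: eq_bigr => p _.
  rewrite contentE (eq_bigr (fun=> y p.2)) => [|x /eqP <-]; last by rewrite ffunE.
  by rewrite prodr_const; congr (_ ^+ _); apply: eq_card => x; rewrite !inE.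
rewrite sum_fixed_colorings; congr (_ * _).
pose T w (i : 'I_n) (m : {ffun Y -> 'I_r.+1}) : R :=
  (nth 0%N lam i + (w : 'S_n) i == \sum_j m j + i)%N%:R * \prod_j y j ^+ m j.
have FE M : F M = \sum_(w : 'S_n) (-1) ^+ w * \prod_i T w i [ffun j => M (i, j)].
  rewrite /F /jt_coef /determinant rmorph_sum mulr_suml; apply: eq_bigr => w _.
  rewrite rmorphM rmorph_sign rmorph_prod -mulrA; congr (_ * _).
  rewrite [\prod_i T _ _ _]big_split /=; congr (_ * _).
    apply: eq_bigr => i _; rewrite mxE rmorph_nat /rows.
    by congr (_ == _ + _)%N%:R; apply: eq_bigr => j _; rewrite ffunE.
  transitivity (\prod_(i < n) \prod_j y j ^+ M (i, j)).
    by rewrite pair_bigA; apply: eq_bigr => -[i j] _.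
  by apply: eq_bigr => i _; apply: eq_bigr => j _; rewrite ffunE.
rewrite (eq_bigr _ (fun M _ => FE M)).
rewrite exchange_big; apply: eq_bigr => w _; rewrite -mulr_sumr; congr (_ * _).
have hE i : jt_mx n (nth 0%N lam) h i (w i) = \sum_m T w i m.
  rewrite mxE /h prod_poly_coef; case: ifPn => [le_i|lt_i].
    rewrite big_mkcond; apply: eq_bigr => m _; rewrite /T.
    rewrite -(eqn_add2r i) subnK // eq_sym.
    by case: eqP; rewrite ?mul1r ?mul0r.
  rewrite big1 // => m _; rewrite /T; case: eqP => [E|]; rewrite ?mul0r //.
  by case/negP: lt_i; rewrite E leq_addl.
rewrite (eq_bigr _ (fun i _ => hE i)) bigA_distr_bigA.
pose f (m : {ffun 'I_n -> {ffun Y -> 'I_r.+1}}) : {ffun 'I_n * Y -> 'I_r.+1} :=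
  [ffun p => m p.1 p.2].
pose f' (M : {ffun 'I_n * Y -> 'I_r.+1}) : {ffun 'I_n -> {ffun Y -> 'I_r.+1}} :=
  [ffun i => [ffun j => M (i, j)]].
have fK : cancel f f' by move=> m; apply/ffunP => i; apply/ffunP => j; rewrite !ffunE.
have f'K : cancel f' f by move=> M; apply/ffunP => -[i j]; rewrite !ffunE.
rewrite [RHS](reindex f') /=; last by exists f => M _.
rewrite [LHS]big_mkcond; apply: eq_bigr => M _; case: ifPn => [_|neq_r].
  by apply: eq_bigr => i _; rewrite ffunE.
(* A matrix whose total is not [r] contributes 0: the row conditions, added over [i], would force
   the total [r]. *)
have [/forallP allE|/forallPn[i neq_i]] := boolP [forall i : 'I_n,
    (nth 0 lam i + w i == \sum_j M (i, j) + i)%N].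
  case/negP: neq_r; rewrite -(eqn_add2r (\sum_(i < n) i)).
  have rE : r = (\sum_(i < n) nth 0 lam i)%N by rewrite sum_nth_sumn // (partition_sumn lamP).
  rewrite [X in _ == (X + _)%N]rE [X in _ == (_ + X)%N](reindex_inj (@perm_inj _ w)) -big_split.
  rewrite (eq_bigr _ (fun i _ => eqP (allE i))) big_split eqn_add2r.
  rewrite pair_bigA; apply/eqP/eq_bigr => -[i j] _ //.
rewrite (bigD1 i) //= /T (_ : (_ == _) = false) ?mul0r //.
apply: contraNF neq_i => /eqP ->; apply/eqP; congr (_ + _)%N.
by apply: eq_bigr => j _; rewrite !ffunE.
Qed.

End JacobiTrudi.

(** * Two-variable specialisation *)

Lemma hockey_stick d k : (\sum_(j < k.+1) 'C((d + j).-1, j) = 'C(d + k, k))%N.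
Proof.
elim: k => [|k IH]; first by rewrite big_ord1 /= !bin0.
by rewrite big_ord_recr IH !addnS /= binS addnC.
Qed.

Lemma coef_geometric_pow (R : comNzRingType) (a : R) B d k : (k < B)%N ->
  ((\poly_(i < B) a ^+ i) ^+ d)`_k = a ^+ k * 'C((d + k).-1, k)%:R.
Proof.
elim: d k => [|d IH] k lt_k.
  rewrite expr0 coef1; case: k lt_k => [|k] lt_k /=; first by rewrite mul1r.
  by rewrite bin_small ?mulr0.
rewrite exprSr coefM addSn /= -hockey_stick natr_sum mulr_sumr.
apply: eq_bigr => j _; have lt_j := ltn_ord j.
rewrite IH ?(leq_ltn_trans _ lt_k) // coef_poly (leq_ltn_trans _ lt_k) ?leq_subr //.
by rewrite mulrAC -exprD subnKC.
Qed.

Section Specializations.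
Variables (K : fieldType) (emb : {rmorphism rat -> K}).

Lemma natr_neq0 k : (0 < k)%N -> k%:R != 0 :> K.
Proof. by rewrite -(rmorph_nat emb) fmorph_eq0 pnatr_eq0 lt0n. Qed.

Lemma natr_inj : injective (fun k : nat => k%:R : K).
Proof.
move=> i j /=; rewrite -!(rmorph_nat emb) => /fmorph_inj /eqP.
by rewrite eqr_nat => /eqP.
Qed.

Lemma poly_eq_on_nat (p q : {poly K}) N :
  (forall k, (N <= k)%N -> p.[k%:R] = q.[k%:R]) -> p = q.
Proof.
move=> eq_pq; apply/eqP; rewrite -subr_eq0; apply/negPn/negP => nz.
pose rs := [seq k%:R : K | k <- iota N (size (p - q))].
have := max_poly_roots nz (rs := rs); rewrite size_map size_iota ltnn => H.
suff: false by []; apply: H; last by rewrite map_inj_uniq ?iota_uniq //; apply: natr_inj.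
apply/allP => x /mapP[k]; rewrite mem_iota => /andP[le_k _] ->.
by rewrite rootE !hornerE eq_pq ?subrr.
Qed.

(* The coefficient of [z ^+ k] in [(1 - z) ^ (- t)] *)
Definition rbin (t : K) k : K := (\prod_(s < k) (t + s%:R)) / k`!%:R.

Lemma rbin_nat d k : rbin d%:R k = 'C((d + k).-1, k)%:R.
Proof.
apply: (mulIf (natr_neq0 (fact_gt0 k))); rewrite /rbin mulfVK ?natr_neq0 ?fact_gt0 //.
rewrite -natrM; elim: k => [|k IH]; first by rewrite big_ord0 bin0.
rewrite big_ord_recr /= IH -natrD -natrM; congr (_%:R).
by rewrite addnS /= factS mulnAC [('C(_, _) * (d + k))%N]mulnC mul_bin_diag mulnA [('C(_, _) * _)%N]mulnC.
Qed.

Variables (a0 a1 : K).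

(** The coefficient of [z ^+ k] in [(1 - a0 z)^(-t0) (1 - a1 z)^(-t1)]. *)
Definition hgen (t0 t1 : K) k : K :=
  \sum_(b < k.+1) a0 ^+ (k - b) * rbin t0 (k - b) * (a1 ^+ b * rbin t1 b).

(** Take [d] variables equal to [a0] and [e] equal to [a1]. *)
Lemma frobenius_nat r lam n d e :
    is_partition_of r lam -> (size lam <= n)%N ->
  \sum_(s : 'S_r) emb (specht_char lam s) *
     \prod_(c in porbits s) (d%:R * a0 ^+ #|c| + e%:R * a1 ^+ #|c|)
  = r`!%:R * \det (jt_mx n (nth 0%N lam) (hgen d%:R e%:R)).
Proof.
move=> lamP le_n; pose y (x : 'I_d + 'I_e) := if x is inl _ then a0 else a1.
transitivity (\sum_(s : 'S_r) emb (specht_char lam s) *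
     \prod_(c in porbits s) \sum_(j : 'I_d + 'I_e) y j ^+ #|c|).
  apply: eq_bigr => s _; congr (_ * _); apply: eq_bigr => c _.
  by rewrite big_sumType /= !sumr_const !card_ord !mulr_natl.
rewrite (frobenius_formula _ _ lamP le_n); congr (_ * _); apply: det_jt_mx_ext => k.
rewrite (sum_nth_sumn le_n) (partition_sumn lamP) -ltnS => lt_k.
rewrite big_sumType /= !prodr_const !card_ord coefMr; apply: eq_bigr => b _.
have lt_b := ltn_ord b.
by rewrite !coef_geometric_pow ?rbin_nat // (leq_ltn_trans _ lt_k) ?leq_subr.
Qed.

Definition rbin_poly k : {poly K} := k`!%:R^-1 *: \prod_(s < k) ('X + s%:R%:P).

Lemma horner_rbin_poly k t : (rbin_poly k).[t] = rbin t k.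
Proof.
rewrite /rbin_poly hornerZ horner_prod mulrC; congr (_ / _).
by apply: eq_bigr => s _; rewrite !hornerE.
Qed.

(** Both sides are polynomials in [t] that agree at all natural numbers; this opens the way to
    [t = - d1]. *)
Lemma frobenius_two_variables r lam n d t :
    is_partition_of r lam -> (size lam <= n)%N ->
  \sum_(s : 'S_r) emb (specht_char lam s) *
     \prod_(c in porbits s) (d%:R * a0 ^+ #|c| + t * a1 ^+ #|c|)
  = r`!%:R * \det (jt_mx n (nth 0%N lam) (hgen d%:R t)).
Proof.
move=> lamP le_n.
pose p : {poly K} := \sum_(s : 'S_r) (emb (specht_char lam s))%:P *
     \prod_(c in porbits s) ((d%:R * a0 ^+ #|c|)%:P + 'X * (a1 ^+ #|c|)%:P).
pose q : {poly K} := (r`!%:R)%:P * \det (jt_mx n (nth 0%N lam) (fun k =>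
  \sum_(b < k.+1) (a0 ^+ (k - b) * rbin d%:R (k - b) * a1 ^+ b) *: rbin_poly b)).
have pE u : p.[u] = \sum_(s : 'S_r) emb (specht_char lam s) *
     \prod_(c in porbits s) (d%:R * a0 ^+ #|c| + u * a1 ^+ #|c|).
  rewrite /p horner_sum; apply: eq_bigr => s _; rewrite hornerM hornerC horner_prod.
  by congr (_ * _); apply: eq_bigr => c _; rewrite hornerD hornerM !hornerC hornerX.
have qE u : q.[u] = r`!%:R * \det (jt_mx n (nth 0%N lam) (hgen d%:R u)).
  rewrite /q hornerM hornerC -horner_evalE -det_map_mx; congr (_ * \det _).
  apply/matrixP => i j; rewrite !mxE; case: ifP => _; last by rewrite rmorph0.
  rewrite [LHS]horner_sum; apply: eq_bigr => b _.
  by rewrite hornerZ horner_rbin_poly mulrA.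
rewrite -pE -qE; congr (_.[_]); apply: (@poly_eq_on_nat _ _ 0%N) => e _.
by rewrite pE qE (frobenius_nat _ _ lamP le_n).
Qed.

End Specializations.

(** * The content formula *)

Section HgenDegenerate.
Variables (K : fieldType) (a0 a1 : K).

Lemma rbin_0 k : rbin (0 : K) k = (k == 0%N)%:R.
Proof.
rewrite /rbin; case: k => [|k]; first by rewrite big_ord0 mul1r invr1.
by rewrite big_ord_recl /= addr0 !mul0r.
Qed.

Lemma hgen_0r t k : hgen a0 a1 t 0 k = a0 ^+ k * rbin t k.
Proof.
rewrite /hgen big_ord_recl big1 => [|b _]; last by rewrite rbin_0 !mulr0.
by rewrite rbin_0 subn0 !mulr1 addr0.
Qed.

Lemma hgen_0l t k : hgen a0 a1 0 t k = a1 ^+ k * rbin t k.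
Proof.
rewrite /hgen big_ord_recr big1 => [|b _] /=; last first.
  by rewrite rbin_0 subn_eq0 leqNgt ltn_ord mulr0 mul0r.
by rewrite subnn rbin_0 !mul1r add0r.
Qed.

End HgenDegenerate.

Lemma monic_size_prod (R : nzRingType) n (Q : 'I_n -> {poly R}) (k : 'I_n -> nat) :
    (forall i, Q i \is monic /\ size (Q i) = (k i).+1) ->
  \prod_i Q i \is monic /\ size (\prod_i Q i) = (\sum_i k i).+1.
Proof.
move=> QP; elim/big_rec2: _ => [|i m p _ [p_monic size_p]].
  by rewrite monic1 size_poly1.
have [Qi_monic size_Qi] := QP i.
rewrite monicMl // p_monic size_monicM ?monic_neq0 // size_p size_Qi.
by rewrite addnS addSn.
Qed.

Section VandermondeFactor.
Variable R : comNzRingType.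

Lemma det_scale_rows n (c : 'I_n -> R) (A : 'M[R]_n) :
  \det (\matrix_(i, j) (c i * A i j)) = (\prod_i c i) * \det A.
Proof.
rewrite mulr_sumr; apply: eq_bigr => s _; rewrite mulrCA; congr (_ * _).
by rewrite -big_split; apply: eq_bigr => i _; rewrite mxE.
Qed.

Definition eval_mx n (x : 'I_n -> R) (Q : 'I_n -> {poly R}) : 'M[R]_n :=
  \matrix_(i, j) (Q j).[x i].
Definition power_mx n (x : 'I_n -> R) : 'M[R]_n := \matrix_(i, k) x i ^+ k.
Definition coef_mx n (Q : 'I_n -> {poly R}) : 'M[R]_n := \matrix_(k, j) (Q j)`_k.

Lemma eval_mxE n (x : 'I_n -> R) (Q : 'I_n -> {poly R}) :
  (forall j, (size (Q j) <= n)%N) -> eval_mx x Q = power_mx x *m coef_mx Q.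
Proof.
move=> szQ; apply/matrixP => i j; rewrite !mxE (horner_coef_wide _ (szQ j)).
by apply: eq_bigr => k _; rewrite !mxE mulrC.
Qed.

Definition ffact_poly m : {poly R} := \prod_(s < m) ('X - s%:R%:P).

Lemma horner_ffact_poly m k : (ffact_poly m).[k%:R] = (k ^_ m)%:R.
Proof.
rewrite horner_prod ffact_prod natr_prod; case: (leqP m k) => [le_mk|lt_km].
  apply: eq_bigr => s _; rewrite hornerXsubC natrB //.
  by rewrite (leq_trans (ltnW (ltn_ord s))).
rewrite (bigD1 (Ordinal lt_km)) //= hornerXsubC subrr mul0r.
by rewrite (bigD1 (Ordinal lt_km)) //= subnn mul0r.
Qed.

Lemma size_ffact_poly m : size (ffact_poly m) = m.+1.
Proof. by rewrite size_prod_XsubC /index_enum -enumT size_enum_ord. Qed.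

End VandermondeFactor.

Lemma solve_ratio (F : fieldType) (b0 b x z v0 v c e y : F) :
    b0 != 0 -> b != 0 -> x != 0 ->
    b0 * x = z * (v0 * c) -> b * x * y = z * e * (v * c) ->
  y = v * b0 / (v0 * b) * e.
Proof.
move=> b0_nz b_nz x_nz E0 E1.
have v0_nz : v0 != 0.
  by apply: contraNneq (mulf_neq0 b0_nz x_nz) => v0_0; rewrite E0 v0_0 mul0r mulr0.
apply: (mulfI (mulf_neq0 b_nz x_nz)); rewrite E1.
apply: (mulIf v0_nz); transitivity (z * (v0 * c) * (e * v)); first by ring.
by rewrite -E0; field; apply/andP.
Qed.

Section ContentFormula.
Variables (r : nat) (lam : seq nat).
Hypothesis lamP : is_partition_of r lam.

Lemma porbits_1 : #|porbits (1%g : 'S_r)| = r.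
Proof.
rewrite card_imset ?card_ord // => x y /eqP; rewrite eq_porbit_mem => /porbitP[k ->].
by rewrite expg1n perm1.
Qed.

Lemma card_porbits_max (s : 'S_r) : (#|porbits s| == r) = (s == 1%g).
Proof.
apply/eqP/eqP => [max_s|->]; last exact: porbits_1.
have /imset_injP inj_s : #|porbit s @: 'I_r| == #|'I_r| by rewrite card_ord -[X in _ == X]max_s.
apply/permP => x; rewrite perm1; apply: inj_s => //.
by have := porbit_perm s 1 x; rewrite expg1.
Qed.

Let n := (size lam).+1.

Let beta (l : seq nat) (i : nat) : nat := (nth 0 l i + (n.-1 - i))%N.

(** After clearing factorials in each row, the entries of column [j] are the values of this
    polynomial at the [beta l i]. Its degree is [n - 1] and it does not depend on [l], so a
    Vandermonde determinant splits off. *)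
Let numerator d (j : 'I_n) : {poly rat} :=
  (ffact_poly rat j \Po ('X + (d - n + j)%:R%:P)) * ffact_poly rat (n.-1 - j).

Let size_numerator d j : (size (numerator d j) <= n)%N.
Proof.
rewrite (leq_trans (size_polyMleq _ _)) // size_comp_poly2 ?size_XaddC //.
by rewrite !size_ffact_poly; have := ltn_ord j; lia.
Qed.

Let jt_entryE l d (i j : 'I_n) : (n <= d)%N ->
  ((beta l i)`! * (d.-1)`!)%:R * jt_mx n (nth 0%N l) (rbin d%:R) i j
  = ((d.-1 - i + nth 0 l i)`!)%:R * (numerator d j).[(beta l i)%:R] :> rat.
Proof.
move=> le_nd; rewrite mxE /numerator hornerM horner_comp hornerD hornerX hornerC.
rewrite -natrD !horner_ffact_poly /beta.
have lt_i := ltn_ord i; have lt_j := ltn_ord j.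
set A := (d.-1 - i + nth 0 l i)%N.
have -> : (nth 0 l i + (n.-1 - i) + (d - n + j) = A + j)%N by rewrite /A; lia.
case: ifP => [le_i|gt_i]; last first.
  rewrite [X in _ = _ * (_ * X%:R)]ffact_small ?mulr0 //.
  by move: gt_i; lia.
set k := (nth 0 l i + j - i)%N.
rewrite (rbin_nat idfun) -!natrM; congr (_%:R).
have E1 : (A`! * (A + j) ^_ j = (d.-1 + k)`!)%N.
  rewrite mulnC -{2}(addnK j A) ffact_fact ?leq_addl //; congr (_`!).
  by rewrite /A /k; lia.
have E2 : ((nth 0 l i + (n.-1 - i))`! = (nth 0 l i + (n.-1 - i)) ^_ (n.-1 - j) * k`!)%N.
  rewrite -(@ffact_fact _ (n.-1 - j)); last by lia.
  by congr (_ * _`!)%N; rewrite /k; lia.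
have E3 : ('C((d + k).-1, k) * (k`! * (d.-1)`!) = (d.-1 + k)`!)%N.
  have -> : (d + k).-1 = (d.-1 + k)%N by lia.
  rewrite -(@bin_fact (d.-1 + k) k) ?leq_addl //.
  by rewrite addnK.
rewrite mulnA E1 -E3 E2; ring.
Qed.

Let rho_coef d := \det (coef_mx (numerator d)).
Let vander l := \det (power_mx (fun i : 'I_n => (beta l i)%:R : rat)).

Let det_jt l d : (n <= d)%N ->
  (\prod_(i < n) ((beta l i)`! * (d.-1)`!)%:R) * \det (jt_mx n (nth 0%N l) (rbin d%:R))
  = (\prod_(i < n) ((d.-1 - i + nth 0 l i)`!)%:R) * (vander l * rho_coef d).
Proof.
move=> le_nd; rewrite -det_scale_rows.
rewrite /vander /rho_coef -det_mulmx -(eval_mxE _ (size_numerator d)) -det_scale_rows.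
by congr (\det _); apply/matrixP => i j; rewrite !mxE -jt_entryE // mxE.
Qed.

Let content_factor d : (n <= d)%N ->
  \prod_(i < n) ((d.-1 - i + nth 0 lam i)`!)%:R
  = (\prod_(i < n) ((d.-1 - i)`!)%:R) * (content_poly lam).[d%:R] :> rat.
Proof.
move=> le_nd; rewrite /content_poly horner_prod big_ord_recr [X in _ = X * _]big_ord_recr /=.
rewrite nth_default // addn0 mulrAC; congr (_ * _); rewrite -big_split /=.
apply: eq_bigr => i _; have lt_i := ltn_ord i.
elim: (nth 0 lam i) => [|k IH]; first by rewrite big_ord0 hornerC mulr1 addn0.
rewrite big_ord_recr /= hornerM mulrA -IH addnS factS mulnC natrM; congr (_ * _).
rewrite !hornerE /=; apply: (addIr i%:R); rewrite addrNK -!natrD; congr (_%:R).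
by move: le_nd lt_i; rewrite /n; lia.
Qed.

Let det_jt_nil d : \det (jt_mx n (nth 0%N [::]) (rbin (d%:R : rat))) = 1.
Proof.
rewrite -det_tr det_trig.
  rewrite big1 // => i _; rewrite !mxE nth_nil leqnn subnn.
  by rewrite /rbin big_ord0 mul1r invr1.
apply/is_trig_mxP => i j lt_ij; rewrite !mxE nth_nil.
by rewrite leqNgt lt_ij.
Qed.

Let det_jt_content : exists c : rat, forall d, (n <= d)%N ->
  \det (jt_mx n (nth 0%N lam) (rbin (d%:R : rat))) = c * (content_poly lam).[d%:R].
Proof.
have fact_neq0 k : k`!%:R != 0 :> rat by rewrite pnatr_eq0 -lt0n fact_gt0.
have prod_neq0 l d : \prod_(i < n) ((beta l i)`! * (d.-1)`!)%:R != 0 :> rat.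
  by apply/prodf_neq0 => i _; rewrite natrM mulf_neq0.
pose b l : rat := \prod_(i < n) ((beta l i)`!)%:R.
have b_neq0 l : b l != 0 by apply/prodf_neq0.
exists (vander lam * b [::] / (vander [::] * b lam)) => d le_nd.
(* The empty partition, with determinant 1, satisfies the same relation; dividing by it eliminates
   [rho_coef d] and the factorials depending on [d]. *)
have := det_jt [::] le_nd; rewrite det_jt_nil mulr1.
rewrite [X in _ = X * _](eq_bigr (fun i : 'I_n => (d.-1 - i)`!%:R)) => [E0|i _]; last by rewrite nth_nil addn0.
have := det_jt lam le_nd; rewrite (content_factor le_nd) => E1.
have splitb l : \prod_(i < n) ((beta l i)`! * (d.-1)`!)%:R = b l * (d.-1)`!%:R ^+ n :> rat.
  by under eq_bigr do rewrite natrM; rewrite big_split prodr_const card_ord.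
rewrite !splitb in E0 E1.
exact: (solve_ratio (b_neq0 _) (b_neq0 _) (expf_neq0 _ (fact_neq0 _)) E0 E1).
Qed.

Lemma sum_specht_char_cycles (t : rat) :
  \sum_(s : 'S_r) specht_char lam s * t ^+ #|porbits s|
  = (specht_dim r lam)%:R * (content_poly lam).[t].
Proof.
have [c cE] := det_jt_content.
pose p : {poly rat} := \sum_(s : 'S_r) specht_char lam s *: 'X^#|porbits s|.
have pE u : p.[u] = \sum_(s : 'S_r) specht_char lam s * u ^+ #|porbits s|.
  by rewrite /p horner_sum; apply: eq_bigr => s _; rewrite hornerZ hornerXn.
have pC : p = (r`!%:R * c) *: content_poly lam.
  apply: (@poly_eq_on_nat _ idfun _ _ n) => d le_nd.
  rewrite pE hornerZ -mulrA -cE //.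
  rewrite (@det_jt_mx_ext _ n _ _ (hgen 1 1 d%:R 0)) => [|k _]; last first.
    by rewrite hgen_0r expr1n mul1r.
  have <- := @frobenius_nat _ idfun 1 1 _ _ n d 0 lamP (leqnSn _).
  apply: eq_bigr => s _; congr (_ * _); rewrite -prodr_const.
  by apply: eq_bigr => o _; rewrite !expr1n mul0r addr0 mulr1.
(* The constant is read off in degree [r]: the content polynomial is monic of that degree, and only
   the identity has [r] cycles. *)
have [cp_monic size_cp] : content_poly lam \is monic /\ size (content_poly lam) = r.+1.
  rewrite -(partition_sumn lamP) -(sum_nth_sumn (leqnn _)).
  apply: monic_size_prod => i; rewrite -[X in _ /\ _ = X.+1]card_ord -sum1_card.
  apply: monic_size_prod => j; rewrite -[X in 'X + X]opprK -rmorphN.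
  by rewrite monicXsubC size_XsubC.
have := congr1 (fun q : {poly rat} => q`_r) pC.
rewrite coefZ (_ : (content_poly lam)`_r = 1) ?mulr1; last first.
  by have /eqP := cp_monic; rewrite lead_coefE size_cp.
rewrite coef_sum (eq_bigr (fun s => if s == 1%g then specht_char lam s else 0)) => [|s _].
  rewrite -big_mkcond big_pred1_eq -specht_dimE => ->.
  by rewrite -hornerZ -pC pE.
rewrite coefZ coefXn eq_sym card_porbits_max.
by case: eqP; rewrite ?mulr1 ?mulr0.
Qed.

End ContentFormula.

(** * Evaluation of the determinant *)

Lemma det_jt_mx_scale (R : comNzRingType) n (lam : nat -> nat) (h : nat -> R) c :
  \det (jt_mx n lam (fun k => c ^+ k * h k))
  = c ^+ (\sum_(i < n) lam i) * \det (jt_mx n lam h).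
Proof.
rewrite mulr_sumr; apply: eq_bigr => w _; rewrite mulrCA; congr (_ * _).
have [/forallP le_w|/forallPn[i lt_w]] := boolP [forall i : 'I_n, (i <= lam i + w i)%N].
  have <- : (\sum_(j < n) (lam j + w j - j) = \sum_(j < n) lam j)%N.
    exact: sum_jt_index.
  rewrite -prodrXr -big_split; apply: eq_bigr => i _.
  by rewrite !mxE le_w.
by rewrite !(bigD1 (P := xpredT) i) //= !mxE (negbTE lt_w) !mul0r mulr0.
Qed.

Section Hgen.
Variables (K : fieldType) (emb : {rmorphism rat -> K}) (a0 a1 : K).
Implicit Types (t : K).

Lemma rbin_0r t : rbin t 0 = 1.
Proof. by rewrite /rbin big_ord0 mul1r invr1. Qed.

Lemma rbin_pascal t k : rbin t k.+1 = rbin t k + rbin (t - 1) k.+1.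
Proof.
have nz := natr_neq0 emb (fact_gt0 k); have nz1 := natr_neq0 emb (ltn0Sn k).
rewrite /rbin big_ord_recr [X in _ + X / _]big_ord_recl /= addr0.
have -> : \prod_(i < k) (t - 1 + (bump 0 i)%:R) = \prod_(i < k) (t + i%:R).
  apply: eq_bigr => i _; rewrite /bump add1n -natr1; ring.
rewrite factS natrM -natr1; rewrite -natr1 in nz1; field.
by rewrite nz nz1.
Qed.

Lemma hgen_0 t0 t1 : hgen a0 a1 t0 t1 0 = 1.
Proof. by rewrite /hgen big_ord1 !rbin_0r !mulr1. Qed.

Lemma hgen_sym t0 t1 k : hgen a0 a1 t0 t1 k = hgen a1 a0 t1 t0 k.
Proof.
rewrite /hgen (reindex_inj rev_ord_inj); apply: eq_bigr => b _ /=.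
by rewrite subSS subKn 1?mulrC // -ltnS.
Qed.

(** Multiplying the series by [1 - a0 z] lowers [t0] by one. *)
Lemma hgen_pascal_l t0 t1 k :
  hgen a0 a1 t0 t1 k.+1 - a0 * hgen a0 a1 t0 t1 k = hgen a0 a1 (t0 - 1) t1 k.+1.
Proof.
rewrite /hgen big_ord_recr [RHS]big_ord_recr /= subnn !rbin_0r addrAC; congr (_ + _).
rewrite mulr_sumr -sumrB; apply: eq_bigr => b _; have le_b : (b <= k)%N by rewrite -ltnS.
rewrite subSn // (rbin_pascal t0) exprS.
set x := a0 ^+ _; set y := rbin t0 _; set z := rbin (t0 - 1) _; set u := a1 ^+ b * _.
by rewrite mulrDr mulrDl addrAC !mulrA subrr add0r.
Qed.

End Hgen.

Lemma hgen_pascal_r (K : fieldType) (emb : {rmorphism rat -> K}) (a0 a1 t0 t1 : K) k :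
  hgen a0 a1 t0 t1 k.+1 - a1 * hgen a0 a1 t0 t1 k = hgen a0 a1 t0 (t1 - 1) k.+1.
Proof. by rewrite !(hgen_sym a0 a1) hgen_pascal_l. Qed.

Section Convolution.
Variables (K : fieldType) (emb : {rmorphism rat -> K}) (a0 a1 : K).

Definition denominator d : {poly K} := (1 - a0 *: 'X) ^+ d.

Lemma denominator_0 d : (denominator d)`_0 = 1.
Proof.
by rewrite -horner_coef0 horner_exp hornerD hornerN hornerZ hornerX hornerC mulr0 subr0 expr1n.
Qed.

Lemma denominator_gt d k : (d < k)%N -> (denominator d)`_k = 0.
Proof.
move=> lt_dk; apply: nth_default; rewrite (leq_trans _ lt_dk) //.
elim: d {lt_dk} => [|d IH]; first by rewrite /denominator expr0 size_poly1.
rewrite /denominator exprSr (leq_trans (size_polyMleq _ _)) //.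
have: (size (1 - a0 *: 'X : {poly K})%R <= 2)%N.
  rewrite (leq_trans (size_polyD _ _)) // geq_max size_poly1 size_polyN.
  by rewrite (leq_trans (size_scale_leq _ _)) // size_polyX.
move=> s2; rewrite -subn1 leq_subLR (leq_trans (leq_add IH s2)) //.
by rewrite addn2 add1n.
Qed.

(** Applying [hgen_pascal_l] [d] times removes the [a0] factor; the series may be truncated after
    degree [k]. *)
Lemma hgen_denominator d t1 k :
  \sum_(b < k.+1) (denominator d)`_b * hgen a0 a1 d%:R t1 (k - b) = a1 ^+ k * rbin t1 k.
Proof.
pose p := \poly_(i < k.+1) hgen a0 a1 d%:R t1 i.
have pE j i : (j <= d)%N -> (i <= k)%N ->
    ((1 - a0 *: 'X) ^+ j * p)`_i = hgen a0 a1 (d - j)%:R t1 i.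
  elim: j i => [|j IH] i lt_jd le_ik; first by rewrite expr0 mul1r subn0 coef_poly ltnS le_ik.
  rewrite exprS -mulrA mulrBl mul1r coefB -scalerAl coefZ coefXM IH ?(ltnW lt_jd) //.
  case: i le_ik => [|i] le_ik /=; first by rewrite mulr0 subr0 !hgen_0.
  rewrite IH ?(ltnW lt_jd) // 1?ltnW // (hgen_pascal_l emb); congr (hgen _ _ _ _ _).
  by rewrite subnS -subn1 [RHS]natrB ?subn_gt0.
have <- : ((1 - a0 *: 'X) ^+ d * p)`_k = a1 ^+ k * rbin t1 k.
  by rewrite pE // subnn hgen_0l.
rewrite coefM; apply: eq_bigr => b _; rewrite coef_poly ltnS leq_subr.
by [].
Qed.

End Convolution.

Section OperatorDeterminant.
Variables (K : fieldType) (a0 a1 : K).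

(* [a0 E - a1], for [E] the translation by [1] *)
Definition shift_op (p : {poly K}) : {poly K} := a0 *: (p \Po ('X + 1)) - a1 *: p.

Lemma horner_shift_op (p : {poly K}) x : (shift_op p).[x] = a0 * p.[x + 1] - a1 * p.[x].
Proof.
by rewrite /shift_op hornerD hornerN !hornerZ horner_comp hornerD hornerX hornerC.
Qed.

Lemma size_shift_op (p : {poly K}) n : (size p <= n)%N -> (size (shift_op p) <= n)%N.
Proof.
move=> le_n; rewrite (leq_trans (size_polyD _ _)) // geq_max size_polyN.
rewrite !(leq_trans (size_scale_leq _ _)) // size_comp_poly2 //.
by rewrite -[1]/(1%:P) size_XaddC.
Qed.

Lemma shift_op_comp (p : {poly K}) (c : K) :
  shift_op (p \Po ('X + c%:P)) = shift_op p \Po ('X + c%:P).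
Proof.
rewrite /shift_op comp_polyB !comp_polyZ -!comp_polyA; congr (_ *: (_ \Po _) - _).
rewrite !comp_polyD !comp_polyX -[1]/(1%:P) !comp_polyC.
by rewrite addrAC.
Qed.

(** The operator is triangular on monomials, [a0 (X + 1)^l - a1 X^l] having coefficient [a0 - a1] in
    degree [l]. *)
Lemma det_shift_op n (x : 'I_n -> K) (B : 'I_n -> {poly K}) :
    (forall j, (size (B j) <= n)%N) ->
  \det (eval_mx x (fun j => shift_op (B j))) = (a0 - a1) ^+ n * \det (eval_mx x B).
Proof.
move=> szB; rewrite !eval_mxE // => [|j]; last exact: size_shift_op.
pose M : 'M[K]_n := \matrix_(k, l) (shift_op 'X^l)`_k.
have -> : coef_mx (fun j => shift_op (B j)) = M *m coef_mx B.
  apply/matrixP => k j; rewrite !mxE.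
  have -> : shift_op (B j) = \sum_(l < n) (B j)`_l *: shift_op 'X^l.
    rewrite {1}(_ : B j = \sum_(l < n) (B j)`_l *: 'X^l); last first.
      rewrite -poly_def; apply/polyP => i; rewrite coef_poly; case: ltnP => // le_ni.
      by rewrite nth_default // (leq_trans (szB j)).
    rewrite /shift_op raddf_sum /= !scaler_sumr -sumrB; apply: eq_bigr => l _.
    by rewrite comp_polyZ scalerBr !scalerA ![_ * (B j)`_l]mulrC.
  by rewrite coef_sum; apply: eq_bigr => l _; rewrite coefZ !mxE mulrC.
rewrite !det_mulmx mulrCA; congr (_ * _); last first.
rewrite -det_tr det_trig.
  rewrite -[n in RHS]card_ord -prodr_const; apply: eq_bigr => k _; rewrite !mxE.
  have lead1 : lead_coef (('X - (-1)%:P) ^+ k : {poly K}) = 1.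
    by apply/monicP; rewrite monic_exp ?monicXsubC.
  rewrite lead_coefE size_exp_XsubC polyCN opprK /= in lead1.
  by rewrite coefB !coefZ coefXn eqxx mulr1 comp_Xn_poly lead1 mulr1.
apply/is_trig_mxP => l k lt_lk; rewrite !mxE.
by apply: nth_default; rewrite (leq_trans (size_shift_op (n := l.+1) _)) // size_polyXn.
Qed.

End OperatorDeterminant.

Section RectangleFactor.
Variables (K : fieldType) (emb : {rmorphism rat -> K}) (a0 a1 : K).
Hypothesis a0_neq0 : a0 != 0.
Variable n : nat.
Hypothesis n_gt0 : (0 < n)%N.

(** The initial polynomial is [x] choose [n - 1], for the series [(1 - a0 z)^(-n)]; each [shift_op]
    brings one factor [1 - a1 z]. *)
Let Q m : {poly K} :=
  iter m (shift_op a0 a1) ((n.-1)`!%:R^-1 *: ffact_poly K n.-1).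

Let size_Q m : (size (Q m) <= n)%N.
Proof.
elim: m => [|m IH] /=; last exact: size_shift_op.
by rewrite (leq_trans (size_scale_leq _ _)) // size_ffact_poly prednK.
Qed.

(* Up to the power of [a0], the coefficients of index greater than [m - n] of
   [(1 - a1 z) ^ m / (1 - a0 z) ^ n] are polynomial of degree less than [n]. *)
Let hgen_poly m x :
  a0 ^+ n.-1 * (if (n.-1 <= x + m)%N then hgen a0 a1 n%:R (- m%:R) (x + m - n.-1)%N else 0)
  = a0 ^+ x * (Q m).[x%:R].
Proof.
elim: m x => [|m IH] x.
  rewrite addn0 oppr0 hgen_0r /= hornerZ horner_ffact_poly; case: leqP => [le_nx|lt_xn]; last first.
    by rewrite ffact_small // !mulr0.
  rewrite mulrA -exprD subnKC // (rbin_nat emb); congr (_ * _).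
  have -> : (n + (x - n.-1)).-1 = x by lia.
  rewrite bin_sub // -bin_ffact natrM mulrCA mulVf ?mulr1 //.
  by apply: (natr_neq0 emb); rewrite fact_gt0.
rewrite /= horner_shift_op natr1 mulrBr !(mulrCA (a0 ^+ x)) mulrA -exprS -!IH.
rewrite mulrCA -mulrBr; congr (_ * _); rewrite addSn addnS.
have -> : - m.+1%:R = - m%:R - 1 :> K by rewrite -natr1 opprD.
case: (ltnP (x + m) n.-1) => [lt_xm|le_xm].
  rewrite mulr0 subr0; case: ifP => // le_n.
  have -> : ((x + m).+1 - n.-1 = 0)%N by lia.
  by rewrite !hgen_0.
by rewrite (leq_trans le_xm) // subSn // (hgen_pascal_r emb).
Qed.

(** With [x i = mu i + n - 1 - i], the entry [(i, j)] is [Q m] at [x i + j] up to powers of [a0]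
    that split into row and column factors. Each [shift_op] in [Q] yields [(a0 - a1)^n], and at
    [m = 0] only the first series remains. *)
Lemma det_jt_mx_rectangle (mu : nat -> nat) m :
  \det (jt_mx n (fun i => mu i + m)%N (hgen a0 a1 n%:R (- m%:R)))
  = (a0 - a1) ^+ (n * m) * a0 ^+ (\sum_(i < n) mu i) * \det (jt_mx n mu (rbin (n%:R : K))).
Proof.
pose x (i : 'I_n) := (mu i + (n.-1 - i))%N.
pose B m (j : 'I_n) : {poly K} := Q m \Po ('X + j%:R%:P).
have szB k j : (size (B k j) <= n)%N by rewrite size_comp_poly2 ?size_XaddC.
pose E k : K := \det (eval_mx (fun i => (x i)%:R) (B k)).
have EE k : E k = (a0 - a1) ^+ (n * k) * E 0%N.
  elim: k => [|k IH]; first by rewrite muln0 mul1r.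
  rewrite mulnS exprD -mulrA -IH -det_shift_op //; congr (\det _).
  by apply/matrixP => i j; rewrite !mxE shift_op_comp.
have detE k : a0 ^+ n.-1 ^+ n * \det (jt_mx n (fun i => mu i + k)%N (hgen a0 a1 n%:R (- k%:R)))
    = \prod_(i < n) a0 ^+ x i * (\prod_(j < n) a0 ^+ j * E k).
  rewrite -[n in _ ^+ n * _]card_ord -prodr_const -det_scale_rows.
  rewrite -[\prod_(j < n) a0 ^+ j * _](_ : \det (\matrix_(i, j) (a0 ^+ j * (B k j).[(x i)%:R])) = _).
    rewrite -det_scale_rows; congr (\det _); apply/matrixP => i j; rewrite !mxE.
    rewrite mulrA -exprD /B horner_comp hornerD hornerX hornerC -natrD -hgen_poly.
    have lt_i := ltn_ord i; congr (_ * _); rewrite /x.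
    have -> : (n.-1 <= mu i + (n.-1 - i) + j + k)%N = (i <= mu i + k + j)%N by lia.
    by case: ifP => // le_i; congr hgen; lia.
  rewrite -det_tr /E -[in RHS]det_tr -det_scale_rows; congr (\det _).
  by apply/matrixP => i j; rewrite !mxE.
have pow_nz : a0 ^+ n.-1 ^+ n != 0 by rewrite !expf_neq0.
apply: (mulfI pow_nz); rewrite detE EE.
have E0 : \det (jt_mx n (fun i => mu i + 0)%N (hgen a0 a1 n%:R (- 0%:R)))
    = a0 ^+ (\sum_(i < n) mu i) * \det (jt_mx n mu (rbin (n%:R : K))).
  rewrite -det_jt_mx_scale; congr (\det _); apply/matrixP => i j; rewrite !mxE addn0.
  by case: ifP => // _; rewrite oppr0 hgen_0r.
rewrite (mulrCA (\prod_(j < n) a0 ^+ j)) (mulrCA (\prod_(i < n) a0 ^+ x i)) -detE E0.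
by rewrite mulrCA !mulrA.
Qed.

End RectangleFactor.

Lemma sum_ord_support (R : nmodType) n1 n2 (G : nat -> R) :
  (forall b, (minn n1 n2 <= b)%N -> G b = 0) -> \sum_(b < n1) G b = \sum_(b < n2) G b.
Proof.
wlog le_n : n1 n2 / (n1 <= n2)%N => [H G0|].
  have [/H->//|/ltnW le_n] := leqP n1 n2.
  by rewrite (H n2 n1) // minnC.
move=> G0; rewrite (big_ord_widen n2 G le_n) big_mkcond; apply: eq_bigr => b _.
by case: ltnP => // le_b; rewrite G0 // geq_min le_b.
Qed.

(** * Block decomposition along the hook *)

Section HookBlocks.
Variables (K : fieldType) (emb : {rmorphism rat -> K}) (a0 a1 : K).

Definition toeplitz d n : 'M[K]_n :=
  \matrix_(j < n, k < n) if (j <= k)%N then (denominator a0 d)`_(k - j) else 0.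

Lemma det_toeplitz d n : \det (toeplitz d n) = 1.
Proof.
rewrite -det_tr det_trig.
  by rewrite big1 // => i _; rewrite !mxE leqnn subnn denominator_0.
by apply/is_trig_mxP => i j lt_ij; rewrite !mxE leqNgt lt_ij.
Qed.

Lemma rbin_opp_gt m k : (m < k)%N -> rbin (- m%:R : K) k = 0.
Proof.
by move=> lt_mk; rewrite /rbin (bigD1 (Ordinal lt_mk)) //= addNr !mul0r.
Qed.

(* Multiplying the power series by [(1 - a0 z) ^ d] clears its denominator; in
   the matrix this is exact only in the columns of index at least [d]. *)
Lemma jt_mx_toeplitz n d t1 (lam : nat -> nat) (i k : 'I_n) : (d <= k)%N ->
  (jt_mx n lam (hgen a0 a1 d%:R t1) *m toeplitz d n) i k
  = if (i <= lam i + k)%N then a1 ^+ (lam i + k - i) * rbin t1 (lam i + k - i) else 0.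
Proof.
move=> le_dk; have lt_k := ltn_ord k; rewrite mxE.
set L := lam i; set h := hgen a0 a1 d%:R t1; set g := denominator a0 d.
pose F j := (if (i <= L + j)%N then h (L + j - i)%N else 0) *
  (if (j <= k)%N then g`_(k - j) else 0).
have -> : \sum_j jt_mx n lam h i j * toeplitz d n j k = \sum_(j < n) F j.
  by apply: eq_bigr => j _; rewrite !mxE.
rewrite (@sum_ord_support _ n k.+1 F) => [|b]; last first.
  by rewrite (minn_idPr _) // => lt_kb; rewrite /F (leqNgt b) lt_kb mulr0.
rewrite (reindex_inj rev_ord_inj) /=.
have [le_i|lt_i] := leqP i (L + k); last first.
  rewrite big1 // => j _; rewrite /F ifF ?mul0r //; apply/negbTE; lia.
set M := (L + k - i)%N.
pose G b := g`_b * (if (b <= M)%N then h (M - b)%N else 0).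
rewrite -(hgen_denominator emb a0 a1 d).
rewrite (eq_bigr (fun j : 'I_k.+1 => G j)) => [|[j lt_j] _] /=; last first.
  rewrite /F /G subSS leq_subr subKn // mulrC.
  have -> : (i <= L + (k - j))%N = (j <= M)%N by rewrite /M; lia.
  by case: ifP => // le_j; congr (_ * h _); rewrite /M; lia.
rewrite (@sum_ord_support _ k.+1 M.+1 G) => [|b].
  by apply: eq_bigr => b _; rewrite /G -ltnS ltn_ord.
rewrite geq_min => /orP[lt_b|lt_b]; last by rewrite /G leqNgt lt_b mulr0.
by rewrite /G denominator_gt ?mul0r // (leq_ltn_trans le_dk).
Qed.

(** After multiplication by the Toeplitz matrix, the columns from [d] on hold coefficients of
    [(1 - a1 z)^m]. In the first [d] rows their indices exceed the degree [m], so the upper right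
    block is zero. *)
Lemma det_jt_mx_hook d e m (lam : nat -> nat) :
    (forall i, (i < d)%N -> (m <= lam i)%N) ->
  \det (jt_mx (d + e) lam (hgen a0 a1 d%:R (- m%:R)))
  = \det (jt_mx d lam (hgen a0 a1 d%:R (- m%:R)))
    * \det (jt_mx e (fun i => lam (d + i)%N) (fun k => a1 ^+ k * rbin (- m%:R) k)).
Proof.
move=> le_m; set h := hgen _ _ _ _.
pose HT : 'M[K]_(d + e) := jt_mx (d + e) lam h *m toeplitz d (d + e).
have detHT : \det HT = \det (jt_mx (d + e) lam h) by rewrite det_mulmx det_toeplitz mulr1.
rewrite -detHT -[HT]submxK.
have -> : ursubmx HT = 0.
  apply/matrixP => i k; rewrite mxE mxE jt_mx_toeplitz /= ?leq_addr // [RHS]mxE.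
  case: ifP => // _; rewrite rbin_opp_gt ?mulr0 //.
  by have := le_m i (ltn_ord i); have := ltn_ord i; lia.
rewrite det_lblock; congr (_ * _); last first.
  congr (\det _); apply/matrixP => i k; rewrite mxE mxE jt_mx_toeplitz /= ?leq_addr // mxE.
  have -> : (lam (d + i) + (d + k) - (d + i) = lam (d + i) + k - i)%N by lia.
  by have -> : (d + i <= lam (d + i) + (d + k))%N = (i <= lam (d + i) + k)%N by lia.
(* The Toeplitz matrix being upper triangular, the upper left block only meets its leading block,
   again of determinant 1. *)
rewrite -[RHS]mulr1 -(det_toeplitz d d) -det_mulmx; congr (\det _).
apply/matrixP => i k; rewrite mxE mxE !mxE big_split_ord /= [X in _ + X]big1 ?addr0.
  by apply: eq_bigr => j _; rewrite !mxE.
by move=> j _; rewrite !mxE /= (leqNgt (d + j)) (leq_trans (ltn_ord k)) ?leq_addr ?mulr0.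
Qed.

End HookBlocks.

Section ShiftedPartitions.
Local Open Scope nat_scope.

Lemma eq_partition (s t : seq nat) : 0 \notin s -> 0 \notin t ->
  (forall i, nth 0 s i = nth 0 t i) -> s = t.
Proof.
elim: s t => [|x s IH] [|y t] //=; rewrite ?inE ?negb_or.
- by move=> _ /andP[ne0 _] /(_ 0) /= /eqP; rewrite (negbTE ne0).
- by move=> /andP[ne0 _] _ /(_ 0) /= /eqP; rewrite eq_sym (negbTE ne0).
move=> /andP[_ s0] /andP[_ t0] eq_st; have /= -> := eq_st 0.
by congr (_ :: _); apply: IH => // i; have := eq_st i.+1.
Qed.

Lemma nth_shift_part d s i : sorted geq s -> nth 0 (shift_part d s) i = nth 0 s i - d.
Proof.
rewrite /shift_part; elim: s i => [|k s IH] i /=; first by rewrite !nth_nil.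
move=> s_s; have /IH{}IH := path_sorted s_s.
have le_k m : nth 0 s m <= k by have := @nth_sorted_geq (k :: s) 0 m.+1 s_s; apply.
case: ltnP => le_dk; first by case: i => [|i] //=.
rewrite IH; case: i => [|i] /=; first by have := le_k 0; lia.
by have := le_k i; have := le_k i.+1; lia.
Qed.

Lemma shift_part_partition d s : sorted geq s ->
  is_partition_of (sumn (shift_part d s)) (shift_part d s).
Proof.
move=> s_s; apply/and3P; split=> //.
  apply/(sortedP 0) => i lt_i; rewrite /= !nth_shift_part //.
  by apply: leq_sub2r; apply: nth_sorted_geq.
apply/negP => /mapP[k]; rewrite mem_filter => /andP[lt_dk _] /eqP.
by rewrite eq_sym subn_eq0 leqNgt lt_dk.
Qed.

Lemma size_partition_le s n : 0 \notin s -> nth 0 s n = 0 -> size s <= n.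
Proof.
move=> s0 sn; rewrite leqNgt; apply/negP => lt_n.
by case/negP: s0; rewrite -sn mem_nth.
Qed.

Lemma drop_partition r s d : is_partition_of r s ->
  is_partition_of (sumn (drop d s)) (drop d s).
Proof.
case/and3P=> s_s s0 _; apply/and3P; split=> //.
  by apply: drop_sorted.
by apply: contra s0 => /mem_drop.
Qed.

Lemma conj_part_drop r s d : is_partition_of r s ->
  conj_part (drop d s) = shift_part d (conj_part s).
Proof.
move=> sP; have dP := drop_partition d sP; have s_s := partition_sorted sP.
have d_s := partition_sorted dP.
have c_s := partition_sorted (conj_part_partition sP).
apply: eq_partition => [||i].
- by case/and3P: (conj_part_partition dP).
- by case/and3P: (shift_part_partition d c_s).
rewrite nth_shift_part // !nth_conj_part //.
apply/eqP; rewrite eqn_leq; apply/andP; split.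
  rewrite leqNgt; apply/negP; rewrite conj_rowP // nth_drop -conj_rowP //; lia.
rewrite leqNgt; apply/negP; rewrite ltn_subRL -[X in X < _](subnKC (leq_addr _ _)).
by rewrite conj_rowP // subnKC ?leq_addr // -nth_drop -conj_rowP // ltnn.
Qed.

End ShiftedPartitions.

Lemma eq_jt_mx (R : comNzRingType) n (lam lam' : nat -> nat) (h h' : nat -> R) :
  (forall i, (i < n)%N -> lam i = lam' i) -> h =1 h' -> jt_mx n lam h = jt_mx n lam' h'.
Proof. by move=> eq_lam eq_h; apply/matrixP => i j; rewrite !mxE eq_lam // eq_h. Qed.

(** Conjugation twists the character by the sign, which is -1 to the number of cycles, up to
    [(-1) ^+ r]. *)
Lemma content_formula_conj r lam (t : rat) : is_partition_of r lam ->
  (specht_dim r lam)%:R * (content_poly lam).[- t]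
  = (-1) ^+ r * ((specht_dim r (conj_part lam))%:R * (content_poly (conj_part lam)).[t]).
Proof.
move=> lamP; rewrite -!sum_specht_char_cycles //; last exact: conj_part_partition.
rewrite mulr_sumr; apply: eq_bigr => s _; rewrite specht_char_conj //.
rewrite /odd_perm card_ord signr_addb !signr_odd (exprNn t) !mulrA -expr2 sqrr_sign mul1r.
by rewrite [specht_char _ _ * _]mulrC.
Qed.

Lemma mul_regroup (R : comNzRingType) (s x y u v : R) :
  s * x * y * u * v = x * u * (s * y * v).
Proof. by ring. Qed.

(** * Assembly of the hook identity *)

Section Main.
Variables (K : fieldType) (emb : {rmorphism rat -> K}).

(** With [d = 0] only the second variable is left in the Frobenius formula, and there [t] is
    arbitrary. *)
Lemma det_jt_mx_rbin r lam n (t : rat) : is_partition_of r lam -> (size lam <= n)%N ->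
  r`!%:R * \det (jt_mx n (nth 0%N lam) (rbin (emb t)))
  = emb ((specht_dim r lam)%:R * (content_poly lam).[t]).
Proof.
move=> lamP le_n; rewrite -(sum_specht_char_cycles lamP) rmorph_sum.
rewrite (eq_jt_mx (lam' := nth 0%N lam) (h' := hgen 1 1 (0%:R : K) (emb t))) // => [|k]; last first.
  by rewrite hgen_0l expr1n mul1r.
rewrite -(frobenius_two_variables emb 1 1 0 (emb t) lamP le_n).
apply: eq_bigr => s _; rewrite rmorphM rmorphXn -prodr_const; congr (_ * _).
by apply: eq_bigr => c _; rewrite mul0r add0r expr1n mulr1.
Qed.

Lemma frobenius_hook r delta d0 d1 (a0 a1 : K) :
    is_partition_of r delta -> max_skew_hook delta (d0, d1) -> a0 != 0 ->
  let mu := shift_part d1 delta in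
  let nu := shift_part d0 (conj_part delta) in
  \sum_(s : 'S_r) emb (specht_char delta s) *
     \prod_(c in porbits s) (d0%:R * a0 ^+ #|c| - d1%:R * a1 ^+ #|c|)
  = r`!%:R * emb ((-1) ^+ sumn nu
      * ((specht_dim (sumn mu) mu)%:R / ((sumn mu)`!)%:R)
      * ((specht_dim (sumn nu) nu)%:R / ((sumn nu)`!)%:R)
      * (content_poly mu).[d0%:R] * (content_poly nu).[d1%:R])
    * ((a0 - a1) ^+ (d0 * d1) * a0 ^+ sumn mu * a1 ^+ sumn nu).
Proof.
move=> deltaP /andP[/and3P[d0_gt0 d1_gt0 le_d1] not_in] a0_nz mu nu.
rewrite /= in d0_gt0 d1_gt0 le_d1.
(* Counting rows from 0, the hook condition says that row [d0 - 1] has length at least [d1] and row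
   [d0] at most [d1]. Hence [mu] has at most [d0] rows. *)
have le_next : (nth 0%N delta d0 <= d1)%N by move: not_in; rewrite /in_diagram /= -ltnNge.
have delta_s := partition_sorted deltaP.
pose nu' := drop d0 delta; pose e := size nu'.
have nuE : nu = conj_part nu' by rewrite [RHS](conj_part_drop _ deltaP).
have nu'P := drop_partition d0 deltaP; rewrite -/nu' in nu'P.
have sum_nu : sumn nu' = sumn nu by rewrite nuE (sumn_conj_part nu'P).
have muP := shift_part_partition d1 delta_s; rewrite -/mu in muP.
have nth_mu i : nth 0%N mu i = (nth 0%N delta i - d1)%N by rewrite nth_shift_part.
have size_mu : (size mu <= d0)%N.
  case/and3P: muP => _ mu0 _; apply: size_partition_le mu0 _.
  by apply/eqP; rewrite nth_mu subn_eq0.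
have row_ge i : (i < d0)%N -> (d1 <= nth 0%N delta i)%N.
  move=> lt_i; rewrite (leq_trans le_d1) //; apply: nth_sorted_geq => //.
  by rewrite -ltnS prednK.
have size_delta : (size delta <= d0 + e)%N by rewrite /e size_drop -leq_subLR.
transitivity (r`!%:R * \det (jt_mx (d0 + e) (nth 0%N delta) (hgen a0 a1 d0%:R (- d1%:R)))).
  rewrite -(frobenius_two_variables emb _ _ _ _ deltaP size_delta).
  by apply: eq_bigr => s _; congr (_ * _); apply: eq_bigr => c _; rewrite mulNr.
rewrite -mulrA; congr (_ * _).
rewrite (det_jt_mx_hook emb _ _ _ row_ge).
rewrite (@eq_jt_mx _ d0 _ (fun i => nth 0%N mu i + d1)%N _ (hgen a0 a1 d0%:R (- d1%:R))) => [|i lt_i|//]; last first.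
  by rewrite nth_mu subnK // row_ge.
rewrite (det_jt_mx_rectangle emb a1 a0_nz d0_gt0) (sum_nth_sumn size_mu).
rewrite (@eq_jt_mx _ e _ (nth 0%N nu') _ (fun k => a1 ^+ k * rbin (- d1%:R) k)) => [|i _|//]; last first.
  by rewrite nth_drop.
rewrite det_jt_mx_scale (sum_nth_sumn (leqnn _)) sum_nu.
have fact_neq0 k : k`!%:R != 0 :> K by rewrite (natr_neq0 emb) // fact_gt0.
have D1 : \det (jt_mx d0 (nth 0%N mu) (rbin (d0%:R : K)))
    = emb ((specht_dim (sumn mu) mu)%:R / ((sumn mu)`!)%:R * (content_poly mu).[d0%:R]).
  apply: (mulfI (fact_neq0 (sumn mu))).
  rewrite -(rmorph_nat emb d0) (det_jt_mx_rbin _ muP size_mu) -(rmorph_nat emb) -rmorphM.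
  by congr (emb _); rewrite [RHS]mulrA [_ * (_ / _)]mulrC divfK // pnatr_eq0 -lt0n fact_gt0.
(* The lower block belongs to [nu'], the conjugate of [nu], at [- d1]; conjugating gives [nu] at
   [d1] and the sign. *)
have D2 : \det (jt_mx e (nth 0%N nu') (rbin (- d1%:R : K)))
    = emb ((-1) ^+ sumn nu * ((specht_dim (sumn nu) nu)%:R / ((sumn nu)`!)%:R)
           * (content_poly nu).[d1%:R]).
  apply: (mulfI (fact_neq0 (sumn nu))).
  rewrite -{1}sum_nu -(rmorph_nat emb d1) -rmorphN (det_jt_mx_rbin _ nu'P (leqnn _)).
  rewrite (content_formula_conj _ nu'P) -nuE sum_nu -(rmorph_nat emb (_`!)) -rmorphM.
  congr (emb _); rewrite !mulrA; congr (_ * _).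
  by rewrite -(mulrA _`!%:R) [_`!%:R * _]mulrC mulfK // pnatr_eq0 -lt0n fact_gt0.
rewrite D1 D2 [(-1) ^+ sumn nu * _ * _ * _ * _](mul_regroup _ _ _ _ _) [in RHS]rmorphM.
by rewrite (mulrACA (_ * _)) mulrC.
Qed.

End Main.

Theorem proposition3p2 (r : nat) (delta : seq nat)
    (hdelta : is_partition_of r delta) (d0 d1 : nat)
    (hd : max_skew_hook delta (d0, d1)) :
  let mu := shift_part d1 delta in
  let nu := shift_part d0 (conj_part delta) in
  let alpha0 : {mpoly rat[2]} := 'X_(0 : 'I_2) in
  let alpha1 : {mpoly rat[2]} := 'X_(1 : 'I_2) in
  comp_mpoly [tuple alpha0; alpha1; d0%:R; - d1%:R] (P r delta) =
  ((specht_dim r delta)%:R * (-1) ^+ sumn nu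
   * ((specht_dim (sumn mu) mu)%:R / ((sumn mu)`!)%:R)
   * ((specht_dim (sumn nu) nu)%:R / ((sumn nu)`!)%:R)
   * (content_poly mu).[d0%:R] * (content_poly nu).[d1%:R])
    *: ((alpha0 - alpha1) ^+ (d0 * d1)
        * alpha0 ^+ sumn mu * alpha1 ^+ sumn nu).
Proof.
move=> mu nu alpha0 alpha1.
(* In the fraction field powers of [alpha0] can be cancelled; the identity comes back by injectivity
   of [tofrac]. *)
pose K : fieldType := {fraction {mpoly rat[2]}}.
pose emb : {rmorphism rat -> K} := GRing.RMorphism.clone _ _ (@tofrac _ \o @mpolyC 2 rat) _.
have embZ x (p : {mpoly rat[2]}) : tofrac (x *: p) = emb x * tofrac p :> K.
  by rewrite -mul_mpolyC tofracM.
have a0_nz : tofrac alpha0 != 0 :> K.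
  rewrite tofrac_eq0; apply/eqP => /(congr1 (mcoeff U_(0%R : 'I_2))%MM) /eqP.
  by rewrite mcoeffXU eqxx mcoeff0 oner_eq0.
have H := frobenius_hook emb (tofrac alpha1) hdelta hd a0_nz.
cbv zeta in H; rewrite -/mu -/nu in H; set c := (X in _ * emb X * _) in H.
have {}H : \sum_(s : 'S_r) specht_char delta s *:
     \prod_(o in porbits s) (alpha0 ^+ #|o| * d0%:R + alpha1 ^+ #|o| * - d1%:R)
   = (r`!%:R * c) *: ((alpha0 - alpha1) ^+ (d0 * d1) * alpha0 ^+ sumn mu * alpha1 ^+ sumn nu).
  apply/eqP; rewrite -tofrac_eq embZ rmorphM rmorph_nat !tofracM !tofracXn tofracB -H.
  apply/eqP; rewrite raddf_sum; apply: eq_bigr => s _; rewrite [LHS]embZ; congr (_ * _).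
  rewrite rmorph_prod; apply: eq_bigr => o _.
  by rewrite rmorphD !rmorphM rmorphN !rmorphXn !rmorph_nat mulrN ![_ * _%:R]mulrC.
set lq := [tuple _; _; _; _].
have cycE (s : 'S_r) : comp_mpoly lq (\prod_(o in porbits s)
      ('X_(0 : 'I_4) ^+ #|o| * 'X_(2 : 'I_4) + 'X_(1 : 'I_4) ^+ #|o| * 'X_(3 : 'I_4)))
    = \prod_(o in porbits s) (alpha0 ^+ #|o| * d0%:R + alpha1 ^+ #|o| * - d1%:R).
  rewrite rmorph_prod; apply: eq_bigr => o _.
  by rewrite rmorphD !rmorphM !rmorphXn /= !comp_mpolyXU.
rewrite /P comp_mpolyZ; set q := \sum_s _.
have -> : comp_mpoly lq q = \sum_(s : 'S_r) specht_char delta s *: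
    \prod_(o in porbits s) (alpha0 ^+ #|o| * d0%:R + alpha1 ^+ #|o| * - d1%:R).
  by rewrite /q raddf_sum; apply: eq_bigr => s _; rewrite -cycE; apply: comp_mpolyZ.
rewrite H scalerA mulrA divfK ?pnatr_eq0 -?lt0n ?fact_gt0 //.
by rewrite /c !mulrA.
Qed.
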